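(* Let $m\ge1$ be an integer and $\epsilon>0$. Let $({\bf m}^n)_{n}$ be a sequence of decks, where ${\bf m}^n=(m_1,\dots,m_n)$ has $n$ distinct types of cards (the multiplicities $m_i$ may depend on $n$). Suppose that for all $n$ one has ${\bf m}^n_{\max}\le m$ and $\epsilon_n\ge\epsilon$. Let $S_{{\bf m}^n}$ be the total number of correct guesses in the complete feedback game on the deck ${\bf m}^n$ under the greedy (optimal) strategy. Then: (i) The mean $\mu_n:=\mathbb{E}[S_{{\bf m}^n}]$ and the variance $\sigma_n^2:=\mathrm{Var}(S_{{\bf m}^n})$ satisfy $$\mu_n\sim\sigma_n^2\sim\left(1+\frac12+\cdots+\frac{1}{{\bf m}^n_{\max}}\right)\ln n\qquad\text{as } n\to+\infty.$$ (ii) There exists a constant $C=C(\epsilon,m)$, depending only on $\epsilon$ and $m$, such that, for all $n\ge3$, $$\sup_{x\in\mathbb{R}}\left|\mathbb{P}\left(\frac{S_{{\bf m}^n}-\mu_n}{\sigma_n}\le x\right)-\Phi(x)\right|\le C\,\frac{\ln\ln n}{\sqrt{\ln n}},$$ where $\Phi$ is the cumulative distribution function of a standard normal random variable.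
   Context: A deck ${\bf m}^n=(m_1,\dots,m_n)$, with integers $m_i\ge1$, is a deck of cards with $n$ distinct types in which the type $i\in\{1,\dots,n\}$ appears exactly $m_i$ times. Write ${\bf m}^n_{\max}=\max_{1\le i\le n}m_i$ for the highest multiplicity, and let $\epsilon_n=\frac1n\#\{i: m_i={\bf m}^n_{\max}\}$ be the fraction of types occurring with the highest multiplicity. Complete feedback game: the deck is shuffled so that all arrangements are equally likely. The player knows the composition of the deck. At each step the player guesses the type of the top card of the deck; then the top card is revealed to the player and removed. The game continues until the deck is exhausted. The score is the total number of correct guesses. Greedy (optimal) strategy: at each step the player guesses a type having the maximum multiplicity among the cards remaining in the deck (ties may be broken arbitrarily; the law of the score does not depend on how they are broken). $a_n\sim b_n$ means $a_n/b_n\to1$; $\ln$ is the natural logarithm. *)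

(* Defs.v *)
From HB Require Import structures.
From mathcomp Require Import all_boot all_order all_algebra finmap.
From mathcomp Require Import all_classical all_reals all_analysis.
Import Order.TTheory GRing.Theory Num.Theory.
Import numFieldNormedType.Exports.

Set Implicit Arguments.
Unset Strict Implicit.
Unset Printing Implicit Defensive.

Local Open Scope classical_set_scope.
Local Open Scope ring_scope.

Definition ncards n (m : 'I_n -> nat) : nat := (\sum_(i < n) m i)%N.

Definition max_mult n (m : 'I_n -> nat) : nat := (\max_(i < n) m i)%N.

Definition max_frac (R : realType) n (m : 'I_n -> nat) : R :=
  #|[set i | m i == max_mult m]%SET|%:R / n%:R.

(* An arrangement lists the types of the cards from top to bottom; cards of the
   same type are indistinguishable. *)
Record arrangement n (m : 'I_n -> nat) := Arrangement {
  cards :> (ncards m).-tuple 'I_n;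
  _ : [forall i, count_mem i cards == m i] }.

HB.instance Definition _ n (m : 'I_n -> nat) := [isSub for @cards n m].
HB.instance Definition _ n (m : 'I_n -> nat) :=
  [Finite of arrangement m by <:].

Fact arrangement_point n (m : 'I_n -> nat) : arrangement m.
Proof.
pose s := flatten [seq nseq (m i) i | i <- enum 'I_n].
have sz : size s == ncards m.
  rewrite /s size_flatten /shape -map_comp sumnE big_map big_enum /=.
  by apply/eqP; apply: eq_bigr => i _; rewrite size_nseq.
have ct : [forall i, count_mem i (Tuple sz) == m i].
  apply/forallP => i /=; rewrite /s count_flatten -map_comp sumnE big_map.
  rewrite big_enum /= (bigD1 i) //= count_nseq /= eqxx mul1n big1 ?addn0 //.
  by move=> j ji; rewrite count_nseq /= (negbTE ji).
exact: Arrangement ct.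
Qed.

HB.instance Definition _ n (m : 'I_n -> nat) :=
  isPointed.Build (arrangement m) (arrangement_point m).
HB.instance Definition _ n (m : 'I_n -> nat) :=
  @isMeasurable.Build default_measure_display (arrangement m)
    discrete_measurable discrete_measurable0
    discrete_measurableC discrete_measurableU.

Section shuffle.
Context (R : realType) n (m : 'I_n -> nat).

Fact card_arrangementV_ge0 : 0 <= (#|{: arrangement m}|%:R : R)^-1.
Proof. by rewrite invr_ge0. Qed.

Definition shuffle : set (arrangement m) -> \bar R :=
  mscale (NngNum card_arrangementV_ge0) (@counting (arrangement m) R).

HB.instance Definition _ := Measure.on shuffle.

Let shuffle_setT : shuffle setT = 1%E.
Proof.
rewrite /shuffle /mscale /= /counting asboolT; last exact: finite_finset.
have -> : fset_set [set: arrangement m] = [fset x in enum {: arrangement m}]%fset.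
  by apply/fsetP => w; rewrite in_fset_set ?inE ?mem_enum ?in_setT //;
     exact: finite_finset.
rewrite card_fseq undup_id ?enum_uniq // -cardE -EFinM mulVf // pnatr_eq0.
by rewrite -lt0n; apply/card_gt0P; exists (arrangement_point m).
Qed.

HB.instance Definition _ :=
  Measure_isProbability.Build _ _ _ shuffle shuffle_setT.

End shuffle.
Arguments shuffle R {n} m.

Definition remaining n (m : 'I_n -> nat) (h : seq 'I_n) (i : 'I_n) : nat :=
  (m i - count_mem i h)%N.

(* The next guess as a function of the cards revealed so far, in the order in
   which they were revealed. [None] is no guess; it is there so that strategies
   also exist for [n = 0]. *)
Definition strategy n := seq 'I_n -> option 'I_n.

(* Only the histories of a game still in progress are constrained, and ties may
   be broken in any way, possibly depending on the whole history. *)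
Definition greedy n (m : 'I_n -> nat) (g : strategy n) : Prop :=
  forall h : seq 'I_n,
    (forall i, (count_mem i h <= m i)%N) -> (size h < ncards m)%N ->
    exists i, g h = Some i /\
      forall j, (remaining m h j <= remaining m h i)%N.

Definition score (R : realType) n (m : 'I_n -> nat) (g : strategy n)
    (w : arrangement m) : R :=
  (\sum_(k < ncards m) (g (take k w) == Some (tnth w k)))%N%:R.
Arguments score R {n} m g w.

Definition score_mean (R : realType) n (m : 'I_n -> nat) (g : strategy n) : R :=
  fine 'E_(shuffle R m)[score R m g]%E.

Definition score_var (R : realType) n (m : 'I_n -> nat) (g : strategy n) : R :=
  fine 'V_(shuffle R m)[score R m g]%E.

Definition asymp_equiv (R : realType) (a b : R^nat) : Prop :=
  a n / b n @[n --> \oo] --> (1 : R).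

Definition std_normal_cdf (R : realType) (x : R) : \bar R :=
  normal_prob 0 1 `]-oo, x].

(* Main.v *)
Require Import Defs.
From HB Require Import structures.
From mathcomp Require Import all_boot all_order all_algebra finmap.
From mathcomp Require Import all_classical all_reals all_analysis.
From mathcomp Require Import ring lra zify.
Import Order.TTheory GRing.Theory Num.Theory.
Import numFieldNormedType.Exports.

(** Suppose that t cards are left and that M_t is the greatest multiplicity among
    them. Given the past, the greedy guess is right with probability M_t / t. The
    cards left are a uniformly random part of the deck, so the mean number of
    k-subsets of equal cards among them is of order n (t/n)^k = (t/T)^k with
    T = n^(1 - 1/k). Hence M_t >= k is unlikely for t far below T, by the first
    moment (top_prob_small), and likely for t far above T, by the second moment
    (top_prob_large), because k-subsets of different types are negatively
    correlated (deal_bin2_le). The standard deviation of the indicator of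
    M_t >= k is therefore O(min(t/T, T/t)). Summing over k and t gives two facts:
    the standard deviations of M_t / t have a bounded sum (sum_spread_le), and the
    means of M_t / t sum to (1 + 1/2 + ... + 1/M) ln n + O(1), where M is the greatest
    multiplicity in the full deck, since the reciprocals of the t between
    n^(1 - 1/k) and n sum to (ln n)/k (mean_top_sum).

    So the success probabilities are nearly deterministic, and the score is compared
    with the sum W of independent Bernoulli variables whose parameters are the means
    of M_t / t. The score and W have the same mean. Their variances differ by
    O(sqrt(ln n)) (score_var_gap), and the variance of W differs from its mean by the
    sum of the squared parameters, which is bounded. This proves the asymptotics of
    the mean and of the variance.

    For the distribution functions, the guesses are replaced by the Bernoulli
    variables one at a time (hits_vs_pbinom). One replacement costs at most the
    standard deviation of M_t / t times the largest atom of the Bernoulli sum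
    still to come. By pbinom_point_le that atom is at most the inverse of the
    standard deviation of that sum, which is O(1 / sqrt(ln n)) except for the last few
    cards, where M_t = 1 with overwhelming probability. Hence the distribution
    functions of the score and of W differ by O(1 / sqrt(ln n))
    (score_cdf_vs_pbinom). Stein's method gives a normal approximation of W with
    error O(1 / sqrt(ln n)) (pbinom_berry_esseen), and passing from the standard
    deviation of W to that of the score costs as much again (Phi_dilation). The
    total error is O(1 / sqrt(ln n)); the factor ln(ln n) is bounded below by the
    positive number ln(ln 3) for n >= 3. *)

Local Open Scope classical_set_scope.
Local Open Scope ring_scope.

Set Implicit Arguments.
Unset Strict Implicit.
Unset Printing Implicit Defensive.

(** * Finite means and Poisson binomial laws *)

(** Expectations only enter through these four properties. All laws below are
    finitely supported and given by recursions, for which they are immediate. *)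
Record is_mean (R : realType) (T : Type) (E : (T -> R) -> R) : Prop := IsMean {
  meanD : forall F G, E (fun x => F x + G x) = E F + E G;
  meanZ : forall c F, E (fun x => c * F x) = c * E F;
  mean_ge0 : forall F, (forall x, 0 <= F x) -> 0 <= E F;
  mean1 : E (fun=> 1) = 1 }.

Section Mean.
Context {R : realType} {T : Type} {E : (T -> R) -> R} (mE : is_mean E).
Implicit Types F G : T -> R.

Lemma eq_mean F G : F =1 G -> E F = E G.
Proof. by move=> FG; congr E; apply/funext. Qed.

Lemma mean_cst c : E (fun=> c) = c.
Proof. by rewrite -[RHS]mulr1 -(mean1 mE) -(meanZ mE); apply: eq_mean => x; rewrite mulr1. Qed.

Lemma meanN F : E (fun x => - F x) = - E F.
Proof. by rewrite -mulN1r -(meanZ mE); apply: eq_mean => x; rewrite mulN1r. Qed.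

Lemma meanB F G : E (fun x => F x - G x) = E F - E G.
Proof. by rewrite (meanD mE) meanN. Qed.

Lemma ler_mean F G : (forall x, F x <= G x) -> E F <= E G.
Proof. by move=> FG; rewrite -subr_ge0 -meanB; apply: (mean_ge0 mE) => x; rewrite subr_ge0. Qed.

Lemma mean_sum (I : Type) (r : seq I) (P : pred I) (F : I -> T -> R) :
  E (fun x => \sum_(i <- r | P i) F i x) = \sum_(i <- r | P i) E (F i).
Proof.
elim: r => [|i r IH].
  by rewrite big_nil -[RHS](mean_cst 0); apply: eq_mean => x; rewrite big_nil.
rewrite big_cons -IH; case: ifP => Pi.
  by rewrite -(meanD mE); apply: eq_mean => x; rewrite big_cons Pi.
by apply: eq_mean => x; rewrite big_cons Pi.
Qed.

(** The quadratic polynomial E((F - lG)^2) in l is nonnegative, so its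
    discriminant is not positive. *)
Lemma mean_CauchySchwarz F G :
  `|E (fun x => F x * G x)| <=
  Num.sqrt (E (fun x => F x ^+ 2)) * Num.sqrt (E (fun x => G x ^+ 2)).
Proof.
set a := E (fun x => F x ^+ 2); set c := E (fun x => G x ^+ 2).
set b := E _.
have a0 : 0 <= a by apply: (mean_ge0 mE) => x; exact: sqr_ge0.
have c0 : 0 <= c by apply: (mean_ge0 mE) => x; exact: sqr_ge0.
have quad l : 0 <= a - 2 * l * b + l ^+ 2 * c.
  have -> : a - 2 * l * b + l ^+ 2 * c = E (fun x => (F x - l * G x) ^+ 2).
    rewrite /a /b /c -!(meanZ mE) -meanB -(meanD mE); apply: eq_mean => x.
    by ring.
  by apply: (mean_ge0 mE) => x; exact: sqr_ge0.
rewrite -sqrtrM // -sqrtr_sqr ler_wsqrtr //.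
have [c_eq0|c_neq0] := eqVneq c 0.
  suff -> : b = 0 by rewrite expr0n /= mulr_ge0.
  apply/eqP; apply: contraT => b0.
  have := quad ((a + 1) / (2 * b)).
  rewrite c_eq0 mulr0 addr0.
  have -> : a - 2 * ((a + 1) / (2 * b)) * b = - 1 by field.
  by rewrite ler0N1.
have cgt0 : 0 < c by rewrite lt_def c_neq0.
have := quad (b / c).
have -> : a - 2 * (b / c) * b + (b / c) ^+ 2 * c = (a * c - b ^+ 2) / c by field.
by rewrite pmulr_lge0 ?invr_gt0 // subr_ge0.
Qed.

Definition sdev F := Num.sqrt (E (fun x => (F x - E F) ^+ 2)).

Lemma sdev_ge0 F : 0 <= sdev F. Proof. exact: sqrtr_ge0. Qed.

Lemma sqr_sdev F : sdev F ^+ 2 = E (fun x => (F x - E F) ^+ 2).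
Proof. by rewrite sqr_sqrtr //; apply: (mean_ge0 mE) => x; exact: sqr_ge0. Qed.

Lemma sdevD F G : sdev (fun x => F x + G x) <= sdev F + sdev G.
Proof.
rewrite -[leRHS]ger0_norm ?addr_ge0 ?sdev_ge0 // -[leRHS]sqrtr_sqr ler_wsqrtr //.
have -> : E (fun x => (F x + G x - E (fun x => F x + G x)) ^+ 2) =
  sdev F ^+ 2 + 2 * E (fun x => (F x - E F) * (G x - E G)) + sdev G ^+ 2.
  rewrite !sqr_sdev -(meanZ mE) -!(meanD mE); apply: eq_mean => x.
  by rewrite (meanD mE); ring.
rewrite sqrrD -[_ * _ *+ 2]mulr_natl lerD2r lerD2l ler_wpM2l //.
exact: le_trans (ler_norm _) (mean_CauchySchwarz _ _).
Qed.

Lemma sdev_cst c : sdev (fun=> c) = 0.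
Proof.
by rewrite /sdev !mean_cst subrr expr0n /= sqrtr0.
Qed.

Lemma eq_sdev F G : F =1 G -> sdev F = sdev G.
Proof. by move=> /funext ->. Qed.

Lemma sdev_sum (I : Type) (r : seq I) (F : I -> T -> R) :
  sdev (fun x => \sum_(i <- r) F i x) <= \sum_(i <- r) sdev (F i).
Proof.
elim: r => [|i r IH].
  rewrite (@eq_sdev _ (fun=> 0)) ?sdev_cst ?big_nil // => x.
  by rewrite big_nil.
rewrite big_cons; apply: le_trans (lerD (lexx _) IH).
apply: le_trans (sdevD _ _).
by rewrite (@eq_sdev _ (fun x => F i x + \sum_(j <- r) F j x)) // => x; rewrite big_cons.
Qed.

Lemma sqr_sdev_indic (A : T -> bool) :
  sdev (fun x => (A x)%:R) ^+ 2 =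
  E (fun x => (A x)%:R) * (1 - E (fun x => (A x)%:R)).
Proof.
rewrite sqr_sdev; set q := E (fun x => (A x)%:R).
rewrite (@eq_mean _ (fun x => (1 - 2 * q) * (A x)%:R + q ^+ 2)).
  by rewrite (meanD mE) (meanZ mE) mean_cst -/q; ring.
by move=> x; case: (A x) => /=; ring.
Qed.

End Mean.

Arguments sdev {R T} E F.

Section PoissonBinomial.
Context {R : realType}.
Implicit Types (ps : seq R) (h f F G : nat -> R).

(** The expectation of h(X_1 + ... + X_r) for independent Bernoulli variables
    X_i with parameters listed in ps. *)
Fixpoint pbinom ps h : R :=
  if ps is p :: ps' then p * pbinom ps' (h \o S) + (1 - p) * pbinom ps' h else h 0%N.

(** The weighted sum of the expectations of F over the laws obtained by leaving
    out one X_i, with weights p_i (1 - p_i). The recursion avoids removing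
    entries from the list. *)
Fixpoint pbinom_stein ps F : R :=
  if ps is p :: ps' then
    p * (1 - p) * pbinom ps' F + (p * pbinom_stein ps' (F \o S) + (1 - p) * pbinom_stein ps' F)
  else 0.

Definition pbinom_mean ps := \sum_(p <- ps) p.
Definition pbinom_var ps := \sum_(p <- ps) p * (1 - p).
Definition probs ps := all (fun p => 0 <= p <= 1) ps.

Lemma pbinom_is_mean ps : probs ps -> is_mean (pbinom ps).
Proof.
move=> pps; split.
- elim: ps pps => //= p ps IH /andP[_ /IH{}IH] F G.
  by rewrite !IH; ring.
- elim: ps pps => //= p ps IH /andP[_ /IH{}IH] c F.
  by rewrite !IH; ring.
- elim: ps pps => //= p ps IH /andP[/andP[p0 p1] /IH{}IH] F F0.
  by rewrite addr_ge0 // mulr_ge0 ?subr_ge0 // IH //= => x; exact: F0.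
- elim: ps pps => //= p ps IH /andP[_ /IH{}IH].
  rewrite -[X in p * pbinom _ X]/(fun=> 1) IH; ring.
Qed.

Lemma pbinom_stein_cst ps c : probs ps -> pbinom_stein ps (fun=> c) = c * pbinom_var ps.
Proof.
elim: ps => /= [|p ps IH]; first by rewrite /pbinom_var big_nil mulr0.
case/andP=> p01 pps; rewrite -[X in p * pbinom_stein _ X]/(fun=> c) (IH pps).
by rewrite (mean_cst (pbinom_is_mean pps)) /pbinom_var big_cons; ring.
Qed.

Lemma pbinom_stein_lin ps c F G : probs ps ->
  pbinom_stein ps (fun w => F w + c * G w) = pbinom_stein ps F + c * pbinom_stein ps G.
Proof.
elim: ps F G => /= [|p ps IH] F G; first by rewrite mulr0 addr0.
case/andP=> p01 pps; have mE := pbinom_is_mean pps.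
rewrite (meanD mE) (meanZ mE) (IH _ _ pps).
rewrite -[pbinom_stein ps (_ \o _)]
  /(pbinom_stein ps (fun w => (F \o S) w + c * (G \o S) w)) (IH _ _ pps); ring.
Qed.

(** Stein's identity: each centred X_i contributes p_i (1 - p_i) times the mean
    increment of f at the sum of the other variables. *)
Lemma pbinom_steinE ps f : probs ps ->
  pbinom ps (fun w => (w%:R - pbinom_mean ps) * f w) =
  pbinom_stein ps (fun w => f w.+1 - f w).
Proof.
elim: ps f => /= [|p ps IH] f; first by rewrite /pbinom_mean big_nil subr0 mul0r.
case/andP=> p01 pps; have mE := pbinom_is_mean pps.
have mu : pbinom_mean (p :: ps) = p + pbinom_mean ps by rewrite /pbinom_mean big_cons.
rewrite (@eq_mean _ _ _ _ (fun w =>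
  (w%:R - pbinom_mean ps) * (f \o S) w + (1 - p) * (f \o S) w)); last first.
  by move=> w /=; rewrite mu -natr1; ring.
rewrite (@eq_mean _ _ (pbinom ps) (fun w => (w%:R - pbinom_mean (p :: ps)) * f w)
  (fun w => (w%:R - pbinom_mean ps) * f w - p * f w)); last first.
  by move=> w /=; rewrite mu; ring.
rewrite (meanB mE) (meanD mE) !(meanZ mE) !IH // (meanB mE).
rewrite -[pbinom_stein ps (_ \o _)]/(pbinom_stein ps (fun w => (f \o S) w.+1 - (f \o S) w)) /comp.
rewrite (meanZ mE) -(IH f pps); ring.
Qed.

(** Leaving out one Bernoulli variable lowers the sum by 0 or 1; this is how the
    leave-one-out means are compared with the mean for the full sum. *)
Lemma pbinom_stein_ge ps F G : probs ps ->
  (forall w, G w <= F w) -> (forall w, G w.+1 <= F w) ->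
  pbinom_var ps * pbinom ps G <= pbinom_stein ps F.
Proof.
elim: ps F G => /= [|p ps IH] F G; first by rewrite /pbinom_var big_nil mul0r.
case/andP=> /andP[p0 p1] pps GF GF1; have mE := pbinom_is_mean pps.
rewrite /pbinom_var big_cons mulrDl.
have q0 : 0 <= 1 - p by rewrite subr_ge0.
apply: lerD.
  rewrite ler_wpM2l ?mulr_ge0 //.
  have -> : pbinom ps F = p * pbinom ps F + (1 - p) * pbinom ps F by ring.
  by rewrite lerD // ler_wpM2l // (ler_mean mE) //= => w; exact: GF1.
rewrite -/(pbinom_var ps) mulrDr !(mulrCA (pbinom_var ps)).
by apply: lerD; rewrite ler_wpM2l //; apply: IH => //= w; (exact: GF || exact: GF1).
Qed.

Lemma pbinom_stein_le ps F G : probs ps ->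
  (forall w, F w <= G w) -> (forall w, F w <= G w.+1) ->
  pbinom_stein ps F <= pbinom_var ps * pbinom ps G.
Proof.
move=> pps FG FG1; have mE := pbinom_is_mean pps.
have := @pbinom_stein_ge ps (fun w => 0 + (-1) * F w) (fun w => - G w) pps.
rewrite pbinom_stein_lin // (pbinom_stein_cst _ pps) mul0r add0r mulN1r (meanN mE) mulrN lerN2.
by apply=> w; rewrite add0r mulN1r lerN2.
Qed.

Lemma pbinom_varE ps : probs ps ->
  pbinom ps (fun w => (w%:R - pbinom_mean ps) ^+ 2) = pbinom_var ps.
Proof.
move=> pps; rewrite (pbinom_steinE (fun w => w%:R - pbinom_mean ps) pps).
rewrite (@eq_mean _ _ (pbinom_stein ps) _ (fun=> 1)) ?pbinom_stein_cst ?mul1r // => w.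
by rewrite -natr1; ring.
Qed.

Lemma pbinom_var_ge0 ps : probs ps -> 0 <= pbinom_var ps.
Proof.
move=> pps; rewrite -pbinom_varE //; apply: mean_ge0 (pbinom_is_mean pps) _ _ => w.
exact: sqr_ge0.
Qed.

(** Apply Stein's identity to a monotone function that takes the values -1, 0, 1
    and jumps only next to a. By Cauchy-Schwarz the left side of the identity is
    at most the standard deviation; the right side is at least the variance
    times the mass of a. *)
Lemma pbinom_point_le ps a : probs ps ->
  Num.sqrt (pbinom_var ps) * pbinom ps (fun w => (w == a)%:R) <= 1.
Proof.
move=> pps; have mE := pbinom_is_mean pps; set s := Num.sqrt _.
have [s0|s0] := eqVneq s 0; first by rewrite s0 mul0r ler01.
have sgt0 : 0 < s by rewrite lt_def s0 sqrtr_ge0.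
pose f w : R := if (w < a)%N then -1 else (w != a)%:R.
have f1 w : f w ^+ 2 <= 1.
  by rewrite /f; case: ifP => _; [|case: eqP => _ /=]; rewrite ?sqrrN ?expr1n ?expr0n /=.
have : pbinom_var ps * pbinom ps (fun w => (w == a)%:R) <= pbinom_stein ps (fun w => f w.+1 - f w).
  by apply: pbinom_stein_ge => // w; rewrite /f;
     case: (ltngtP w a) => h; case: (ltngtP w.+1 a) => h' //=;
     first [lra | exfalso; lia].
rewrite -pbinom_steinE // => H; rewrite -(ler_pM2l sgt0) mulr1 mulrA.
have -> : s * s = pbinom_var ps by rewrite -expr2 sqr_sqrtr // pbinom_var_ge0.
apply: le_trans H _; apply: le_trans (ler_norm _) _.
apply: le_trans (mean_CauchySchwarz mE _ _) _.
rewrite pbinom_varE // -/s -[leRHS]mulr1 ler_wpM2l ?sqrtr_ge0 // -[leRHS]sqrtr1 ler_wsqrtr //.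
by rewrite -[leRHS](mean1 mE); apply: (ler_mean mE).
Qed.

End PoissonBinomial.

(** * The standard normal law and Stein's equation *)

Section RealDerivatives.
Context {R : realType}.

Lemma mean_value (f df : R -> R) (a b : R) : a <= b ->
  (forall x, a <= x <= b -> is_derive x 1 f (df x)) ->
  exists2 c, a <= c <= b & f b - f a = df c * (b - a).
Proof.
move=> ab fdf.
have [c] : exists2 c, c \in `[a, b]%R & f b - f a = df c * (b - a).
  apply: MVT_segment => // [x|].
    by rewrite in_itv /= => /andP[/ltW ax /ltW xb]; apply: fdf; rewrite ax.
  apply: derivable_within_continuous => x; rewrite in_itv /= => axb.
  exact: (@ex_derive _ _ _ _ _ _ _ (fdf x axb)).
by rewrite in_itv /=; exists c.
Qed.

Lemma is_derive_mul (f g : R -> R) (x a b : R) :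
  is_derive x 1 f a -> is_derive x 1 g b ->
  is_derive x 1 (fun y => f y * g y) (a * g x + f x * b).
Proof.
move=> fa gb; apply: (is_derive_eq (is_deriveM fa gb)).
by rewrite addrC; congr (_ + _); exact: mulrC.
Qed.

Lemma is_derive_add (f g : R -> R) (x a b : R) :
  is_derive x 1 f a -> is_derive x 1 g b ->
  is_derive x 1 (fun y => f y + g y) (a + b).
Proof. exact: is_deriveD. Qed.

Lemma is_derive_opp (f : R -> R) (x a : R) :
  is_derive x 1 f a -> is_derive x 1 (fun y => - f y) (- a).
Proof. exact: is_deriveN. Qed.

Lemma is_derive_inv (f : R -> R) (x a : R) : f x != 0 ->
  is_derive x 1 f a -> is_derive x 1 (fun y => (f y)^-1) (- a / f x ^+ 2).
Proof.
move=> fx0 fa; apply: (is_derive_eq (is_deriveV fx0 fa)).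
by rewrite -[_ *: _]/(- (f x ^+ 2)^-1 * a) mulNr mulrC mulNr.
Qed.

End RealDerivatives.

Section StandardNormal.
Context {R : realType}.
Implicit Types x y z : R.

Definition gauss z : R := normal_peak 1 * expR (- (z ^+ 2 / 2)).
Definition Phi z : R := fine (std_normal_cdf z).

Lemma gaussE : gauss = normal_pdf 0 1.
Proof.
rewrite (normal_pdfE _ (oner_neq0 R)); apply/funext => z.
by rewrite /gauss /normal_fun subr0 expr1n mulNr.
Qed.

Lemma gauss_gt0 z : 0 < gauss z.
Proof. by rewrite mulr_gt0 ?expR_gt0 ?normal_peak_gt0 ?oner_eq0. Qed.

Lemma gaussN z : gauss (- z) = gauss z.
Proof. by rewrite /gauss sqrrN. Qed.

Lemma is_derive_gauss z : is_derive z 1 gauss (- z * gauss z).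
Proof.
have sq : is_derive z 1 (fun y => y ^+ 2) (1 * z + z * 1).
  exact: (is_derive_mul (is_derive_id z 1) (is_derive_id z 1)).
have := is_derive_mul sq (is_derive_cst ((2^-1 : R)) z 1).
move=> /(is_derive_opp) /(is_derive1_comp (is_derive_expR _)).
move=> /(is_derive_mul (is_derive_cst (normal_peak 1 : R) z 1)) /is_derive_eq; apply.
by rewrite /gauss /=; field.
Qed.

Lemma std_normal_cdfE z : std_normal_cdf z = (Phi z)%:E.
Proof. by rewrite fineK // fin_num_measure. Qed.

Lemma is_derive_Phi z : is_derive z 1 Phi (gauss z).
Proof.
have [] := @continuous_FTC1 R gauss (BInfty _ true) z (z + 1) _ _ _ _.
- by rewrite ltrDl.
- rewrite gaussE; exact: (integrableS measurableT _ _ (integrable_normal_pdf 0 1)).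
- by rewrite ltNyr.
- rewrite gaussE; exact: (@continuous_normal_pdf R 0 1 (oner_neq0 R) z).
move=> h1 h2; rewrite derive1E in h2.
have -> : Phi = (fun y : R => \int[lebesgue_measure]_(t in `]-oo, y]) gauss t).
  by apply/funext => y; rewrite /Phi /std_normal_cdf /normal_prob /Rintegral gaussE.
by rewrite -h2; exact: DeriveDef.
Qed.

Lemma Phi_ge0 z : 0 <= Phi z.
Proof. by rewrite fine_ge0. Qed.

Lemma Phi_le1 z : Phi z <= 1.
Proof. by rewrite -lee_fin -std_normal_cdfE; exact: probability_le1. Qed.

Let idR : measurableTypeR R -> R := idfun.
#[local] HB.instance Definition _ := @isMeasurableFun.Build _ _ _ _ idR (@measurable_id _ _ setT).

Lemma Phi_small e : 0 < e -> exists y, forall z, z <= y -> Phi z < e.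
Proof.
move=> e0.
have := @cvg_cdfNy0 _ _ R (normal_prob 0 1) idR.
move=> /fine_cvgP [_] /cvgr_lt /(_ _ e0) [M [_ hM]].
by exists (M - 1) => z zM; apply: hM; rewrite (le_lt_trans zM) // gtrBl.
Qed.

Lemma Phi_big e : 0 < e -> exists y, forall z, y <= z -> 1 - Phi z < e.
Proof.
move=> e0.
have := @cvg_cdfy1 _ _ R (normal_prob 0 1) idR.
have e1 : 1 - e < 1 by rewrite gtrBl.
move=> /fine_cvgP [_] /cvgr_gt /(_ _ e1) [M [_ hM]].
exists (M + 1) => z zM; rewrite ltrBlDr addrC -ltrBlDr; apply: hM.
by rewrite (lt_le_trans _ zM) // ltrDl.
Qed.

Section MillsRatio.
Variable F : R -> R.
Hypothesis dF : forall z, is_derive z 1 F (gauss z).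
Hypothesis F0 : forall z, 0 <= F z.
Hypothesis F1 : forall z, F z <= 1.
Hypothesis Fsmall : forall e, 0 < e -> exists y, forall z, z <= y -> F z < e.

(** The function gauss(z) / (-z) - F(z) has derivative gauss(z) / z^2 on z < 0, so it
    increases, and it is not negative at minus infinity because F vanishes there. *)
Lemma mills z : z < 0 -> - z * F z <= gauss z.
Proof.
move=> z0; rewrite mulrC -ler_pdivlMr ?oppr_gt0 // leNgt; apply/negP => H.
pose d := F z - gauss z / - z.
have d0 : 0 < d by rewrite subr_gt0.
have [y yP] := Fsmall d0.
pose y' := Num.min y z.
have y'z : y' <= z by rewrite ge_min lexx orbT.
have Fy' : F y' < d by apply: yP; rewrite ge_min lexx.
have dg w : y' <= w <= z -> is_derive w 1 (fun w => gauss w * (- w)^-1 + - F w)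
    (gauss w / w ^+ 2).
  move=> /andP[_ wz]; have w0 : w < 0 by rewrite (le_lt_trans wz).
  have nw0 : - w != 0 by rewrite oppr_eq0 lt_eqF.
  have di := is_derive_inv nw0 (is_derive_opp (is_derive_id w 1)).
  apply: (is_derive_eq (is_derive_add (is_derive_mul (is_derive_gauss w) di)
    (is_derive_opp (dF w)))).
  have {}w0 : w != 0 by rewrite lt_eqF.
  by field.
have [c /andP[yc cz] E] := mean_value y'z dg.
have : 0 <= gauss c / c ^+ 2 * (z - y').
  by rewrite !mulr_ge0 ?subr_ge0 ?invr_ge0 ?sqr_ge0 // ltW // gauss_gt0.
rewrite -E; apply/negP; rewrite -ltNge.
have : 0 <= gauss y' / - y'.
  by rewrite divr_ge0 ?(ltW (gauss_gt0 _)) // oppr_ge0 ltW // (le_lt_trans y'z).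
move: Fy'; rewrite /d; lra.
Qed.

Definition mills_bound : R := 1 + (gauss 1)^-1.

Lemma mills_bounded z : z <= 0 -> F z <= mills_bound * gauss z.
Proof.
move=> z0; have [z1|z1] := ltP z (-1).
  have z00 : z < 0 by rewrite (lt_trans z1) // ltrN10.
  apply: (@le_trans _ _ (gauss z)).
    apply: le_trans (mills z00); rewrite ler_peMl //; lra.
  by rewrite ler_peMl ?(ltW (gauss_gt0 _)) // lerDl invr_ge0 ltW // gauss_gt0.
apply: le_trans (F1 z) _.
have : gauss 1 <= gauss z.
  rewrite /gauss ler_pM2l ?normal_peak_gt0 ?oner_eq0 // ler_expR lerN2.
  by rewrite ler_pM2r ?invr_gt0 // expr1n expr2; nra.
move=> h; rewrite /mills_bound mulrDl mul1r ler_wpDl ?(ltW (gauss_gt0 _)) //.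
by rewrite mulrC ler_pdivlMr ?gauss_gt0 // mul1r.
Qed.

End MillsRatio.

(** The upper tail, reflected, is again a primitive of the density that
    vanishes at minus infinity. This transfers the bounds on Phi to 1 - Phi. *)
Lemma is_derive_Phi_sym z : is_derive z 1 (fun y => 1 - Phi (- y)) (gauss z).
Proof.
have h1 := @is_derive1_comp R Phi -%R z _ _ (is_derive_Phi _) (is_deriveNid z 1).
apply: (is_derive_eq (is_derive_add (is_derive_cst (1 : R) z 1) (is_derive_opp h1))).
by rewrite gaussN; ring.
Qed.

Lemma Phi_left z : z <= 0 -> Phi z <= mills_bound * gauss z /\ - z * Phi z <= gauss z.
Proof.
move=> z0; split.
  exact: (mills_bounded is_derive_Phi Phi_ge0 Phi_le1 Phi_small).
have [->|z1] := eqVneq z 0; first by rewrite oppr0 mul0r (ltW (gauss_gt0 _)).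
by apply: (mills is_derive_Phi Phi_small); rewrite lt_def eq_sym z1.
Qed.

Lemma Phi_right z : 0 <= z ->
  1 - Phi z <= mills_bound * gauss z /\ z * (1 - Phi z) <= gauss z.
Proof.
move=> z0.
have ge0 y : 0 <= 1 - Phi (- y) by rewrite subr_ge0 Phi_le1.
have le1 y : 1 - Phi (- y) <= 1 by rewrite gerBl Phi_ge0.
have small e : 0 < e -> exists y, forall z, z <= y -> 1 - Phi (- z) < e.
  by move=> /Phi_big[y yP]; exists (- y) => w wy; apply: yP; rewrite lerNr.
have nz : - z <= 0 by rewrite oppr_le0.
split.
  have := mills_bounded is_derive_Phi_sym ge0 le1 small nz.
  by rewrite opprK gaussN.
have [->|z1] := eqVneq z 0; first by rewrite mul0r (ltW (gauss_gt0 _)).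
have nz' : - z < 0 by rewrite oppr_lt0 lt_def z1.
by have := mills is_derive_Phi_sym small nz'; rewrite !opprK gaussN.
Qed.

Lemma Phi_mono x y : x <= y -> Phi x <= Phi y.
Proof.
move=> xy; have [c _ h] := mean_value xy (fun z _ => is_derive_Phi z).
by rewrite -subr_ge0 h mulr_ge0 ?subr_ge0 // ltW // gauss_gt0.
Qed.

Lemma gauss_absM_le z : `|z| * gauss z <= normal_peak 1.
Proof.
rewrite /gauss mulrCA -[leRHS]mulr1 ler_wpM2l ?normal_peak_ge0 //.
rewrite expRN ler_pdivrMr ?expR_gt0 // mul1r.
apply: le_trans (expR_ge1Dx _); rewrite -(real_normK (num_real z)).
by have := sqr_ge0 (`|z| - 1); nra.
Qed.

(** By the mean value theorem the difference is |x| |s - 1| gauss(c) with c between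
    x and s x, hence |x| <= 2 |c|, and |c| gauss(c) is bounded. *)
Lemma Phi_dilation s x : 2^-1 <= s ->
  `|Phi (s * x) - Phi x| <= 2 * normal_peak 1 * `|s - 1|.
Proof.
move=> s2.
have [c hc ->] : exists2 c, `|x| <= 2 * `|c| &
    Phi (s * x) - Phi x = gauss c * (s * x - x).
  have [xs|/ltW xs] := leP x (s * x).
    have [c /andP[c1 c2] h] := mean_value xs (fun z _ => is_derive_Phi z).
    by exists c => //; case: (ger0P x) => ?; case: (ger0P c) => ?; nra.
  have [c /andP[c1 c2] h] := mean_value xs (fun z _ => is_derive_Phi z).
  exists c; first by case: (ger0P x) => ?; case: (ger0P c) => ?; nra.
  by rewrite -opprB h; ring.
have -> : gauss c * (s * x - x) = (gauss c * x) * (s - 1) by ring.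
rewrite normrM ler_wpM2r // normrM (gtr0_norm (gauss_gt0 c)) mulrC.
have := gauss_absM_le c; have := gauss_gt0 c; nra.
Qed.

Section SteinSolution.
Variable x : R.

(** Stein's equation f'(z) - z f(z) = 1(z <= x) - Phi(x) has the solution that
    equals stein_left on z <= x and stein_right on z >= x. Each branch is
    smooth on the whole line, which avoids differentiating at the corner x. *)
Definition stein_left z := Phi z / gauss z * (1 - Phi x).
Definition stein_right z := (1 - Phi z) / gauss z * Phi x.
Definition stein z := if z <= x then stein_left z else stein_right z.

Lemma is_derive_invgauss z : is_derive z 1 (fun z => (gauss z)^-1) (z / gauss z).
Proof.
have g0 : gauss z != 0 by rewrite gt_eqF ?gauss_gt0.
apply: (is_derive_eq (is_derive_inv g0 (is_derive_gauss z))).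
by field.
Qed.

Lemma is_derive_stein_left z :
  is_derive z 1 stein_left (z * stein_left z + (1 - Phi x)).
Proof.
have g0 : gauss z != 0 by rewrite gt_eqF ?gauss_gt0.
apply: (is_derive_eq (is_derive_mul (is_derive_mul (is_derive_Phi z)
  (is_derive_invgauss z)) (is_derive_cst (1 - Phi x : R) z 1))).
by rewrite /stein_left /=; field.
Qed.

Lemma is_derive_stein_right z :
  is_derive z 1 stein_right (z * stein_right z - Phi x).
Proof.
have g0 : gauss z != 0 by rewrite gt_eqF ?gauss_gt0.
apply: (is_derive_eq (is_derive_mul (is_derive_mul
  (is_derive_add (is_derive_cst (1 : R) z 1) (is_derive_opp (is_derive_Phi z)))
  (is_derive_invgauss z)) (is_derive_cst (Phi x : R) z 1))).
by rewrite /stein_right /=; field.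
Qed.

(** For z <= 0 this is the bound on Phi(z) / gauss(z). For 0 <= z <= x the factor
    1 - Phi(x) is at most 1 - Phi(z), so the bound on the upper tail applies. *)
Lemma stein_left_bound z : z <= x ->
  `|stein_left z| <= mills_bound /\ `|z * stein_left z| <= 1.
Proof.
move=> zx; have g0 := gauss_gt0 z.
have P0 := Phi_ge0 z; have P1 := Phi_le1 z; have Q0 := Phi_ge0 x; have Q1 := Phi_le1 x.
have PQ := Phi_mono zx.
have nE : `|stein_left z| = Phi z * (1 - Phi x) / gauss z.
  by rewrite ger0_norm /stein_left; [ring | rewrite mulr_ge0 ?subr_ge0 // divr_ge0 // ltW].
rewrite (normrM z) nE.
rewrite mulrA !ler_pdivrMr // mul1r.
have [z0|/ltW z0] := leP z 0.
  have [h1 h2] := Phi_left z0; rewrite (ler0_norm z0).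
  by split; nra.
have [h1 h2] := Phi_right z0; rewrite (ger0_norm z0).
by split; nra.
Qed.

Lemma stein_right_bound z : x <= z ->
  `|stein_right z| <= mills_bound /\ `|z * stein_right z| <= 1.
Proof.
move=> zx; have g0 := gauss_gt0 z.
have P0 := Phi_ge0 z; have P1 := Phi_le1 z; have Q0 := Phi_ge0 x; have Q1 := Phi_le1 x.
have PQ := Phi_mono zx.
have nE : `|stein_right z| = (1 - Phi z) * Phi x / gauss z.
  by rewrite ger0_norm /stein_right; [ring | rewrite mulr_ge0 // divr_ge0 ?subr_ge0 // ltW].
rewrite (normrM z) nE.
rewrite mulrA !ler_pdivrMr // mul1r.
have [z0|/ltW z0] := leP z 0.
  have [h1 h2] := Phi_left z0; rewrite (ler0_norm z0).
  by split; nra.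
have [h1 h2] := Phi_right z0; rewrite (ger0_norm z0).
by split; nra.
Qed.

End SteinSolution.

End StandardNormal.

(** * A Berry-Esseen bound for Poisson binomial laws *)

Section SteinDifference.
Context {R : realType}.
Implicit Types x y z d : R.

Lemma mills_bound_ge1 : 1 <= mills_bound :> R.
Proof. by rewrite lerDl invr_ge0 ltW // gauss_gt0. Qed.

(** The derivative of the Stein solution, read off from Stein's equation, with
    the left derivative at the corner x. *)
Definition stein_deriv x z := z * stein x z + ((z <= x)%R%:R - Phi x).

(** The derivative z f(z) + k is Lipschitz on bounded sets because f is bounded
    and Lipschitz, so a difference quotient differs from it by O((1 + |y|) (b - a)). *)
Lemma branch_diff (f : R -> R) (k a b y : R) : a <= b -> a <= y <= b ->
  `|k| <= 1 ->
  (forall z, a <= z <= b -> is_derive z 1 f (z * f z + k)) ->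
  (forall z, a <= z <= b -> `|f z| <= mills_bound /\ `|z * f z| <= 1) ->
  `|f b - f a - (b - a) * (y * f y + k)| <=
    (b - a) ^+ 2 * (mills_bound + 2 * `|y|) /\ `|f b - f a| <= 2 * (b - a).
Proof.
move=> ab /andP[ay yb] k1 df bf.
have ba : 0 <= b - a by rewrite subr_ge0.
have [c /andP[ac cb] ->] := mean_value ab df.
have [c1 c2] := bf c (introT andP (conj ac cb)).
have [c' hc' E] : exists2 c', a <= c' <= b & f c - f y = (c' * f c' + k) * (c - y).
  have [yc|/ltW cy] := leP y c.
    have dyc z : y <= z <= c -> is_derive z 1 f (z * f z + k).
      by move=> /andP[h1 h2]; apply: df; rewrite (le_trans ay) // (le_trans h2).
    have [c' /andP[h1 h2] E] := mean_value yc dyc; exists c' => //.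
    by rewrite (le_trans ay) // (le_trans h2).
  have dyc z : c <= z <= y -> is_derive z 1 f (z * f z + k).
    by move=> /andP[h1 h2]; apply: df; rewrite (le_trans ac) // (le_trans h2).
  have [c' /andP[h1 h2] E] := mean_value cy dyc; exists c'.
    by rewrite (le_trans ac) // (le_trans h2).
  by rewrite -opprB E; ring.
have [_ c'2] := bf c' hc'.
have lip t : `|t| <= 1 -> `|t + k| <= 2.
  by move=> h; rewrite (le_trans (ler_normD _ _)) //; lra.
have cy_ba : `|c - y| <= b - a by rewrite ler_norml; lra.
split; last first.
  by rewrite normrM (ger0_norm ba) ler_wpM2r // lip.
have -> : (c * f c + k) * (b - a) - (b - a) * (y * f y + k) =
   (b - a) * ((c - y) * f c + y * (f c - f y)) by ring.
rewrite expr2 -mulrA normrM (ger0_norm ba) ler_wpM2l //.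
apply: (le_trans (ler_normD _ _)); rewrite [leRHS]mulrDr.
apply: lerD; rewrite normrM; first by rewrite ler_pM.
rewrite E normrM (_ : (b - a) * (2 * `|y|) = `|y| * (2 * (b - a))); last by ring.
by rewrite ler_wpM2l // ler_pM ?lip.
Qed.

(** Away from the corner this is branch_diff. If the corner lies in the step, both
    the difference quotient and the derivative are at most 2 in absolute
    value, which gives the second error term. *)
Lemma stein_diff x z d y : 0 < d -> z <= y <= z + d ->
  `|stein x (z + d) - stein x z - d * stein_deriv x y| <=
  d * (d * (mills_bound + 2 * `|y|) + 4 * (z <= x < z + d)%R%:R).
Proof.
move=> d0 /andP[zy yd].
have [P0 P1] : 0 <= Phi x /\ Phi x <= 1 by rewrite Phi_ge0 Phi_le1.
have zd : z <= z + d by rewrite lerDl ltW.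
have Q1 : `|1 - Phi x| <= 1 by rewrite ler_norml; lra.
have Q2 : `|- Phi x| <= 1 by rewrite ler_norml; lra.
have sl w : w <= x -> stein x w = stein_left x w by rewrite /stein => ->.
have slr : stein_left x x = stein_right x x by rewrite /stein_left /stein_right; ring.
have sr w : x <= w -> stein x w = stein_right x w.
  rewrite le_eqVlt => /predU1P[<-|xw]; first by rewrite -slr sl.
  by rewrite /stein leNgt xw.
have K1 := mills_bound_ge1.
have dE : z + d - z = d by ring.
have nn : 0 <= d * (d * (mills_bound + 2 * `|y|)).
  have K0 : 0 <= mills_bound + 2 * `|y| by have := normr_ge0 y; lra.
  by rewrite !mulr_ge0 ?(ltW d0).
have [zdx|xzd] := leP (z + d) x.
  rewrite andbF mulr0 addr0 sl // sl ?(le_trans zd) //.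
  have yx : y <= x by rewrite (le_trans yd).
  rewrite /stein_deriv yx sl //.
  have [|w _|w /andP[_ h]|h _] :=
    @branch_diff (stein_left x) (1 - Phi x) z (z + d) y zd _ Q1; rewrite ?zy //.
  - exact: is_derive_stein_left.
  - by apply: stein_left_bound; rewrite (le_trans h).
  - by move: h; rewrite dE expr2 -mulrA.
have [zx|xz] := leP z x; last first.
  rewrite mulr0 addr0 (sr (z + d)) ?(ltW xzd) // (sr z) ?(ltW xz) //.
  have xy : x < y by rewrite (lt_le_trans xz).
  rewrite /stein_deriv (leNgt y x) xy sr ?(ltW xy) //= add0r.
  have [|w _|w /andP[h _]|h _] :=
    @branch_diff (stein_right x) (- Phi x) z (z + d) y zd _ Q2; rewrite ?zy //.
  - exact: is_derive_stein_right.
  - by apply: stein_right_bound; rewrite (le_trans (ltW xz)).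
  - by move: h; rewrite dE expr2 -mulrA.
rewrite /= mulr1 (mulrDr d _ 4).
have [|w _|w /andP[_ h]|_ h1] :=
    @branch_diff (stein_left x) (1 - Phi x) z x x zx _ Q1; rewrite ?zx ?lexx //.
- exact: is_derive_stein_left.
- exact: stein_left_bound.
have [|w _|w /andP[h _]|_ h2] :=
    @branch_diff (stein_right x) (- Phi x) x (z + d) x (ltW xzd) _ Q2; rewrite ?lexx ?(ltW xzd) //.
- exact: is_derive_stein_right.
- exact: stein_right_bound.
have h3 : `|stein_deriv x y| <= 2.
  rewrite /stein_deriv; have [yx|/ltW xy] := leP y x.
    have [_] := stein_left_bound yx; rewrite sl // => h.
    by rewrite (le_trans (ler_normD _ _)) //; lra.
  have [_] := stein_right_bound xy; rewrite sr // => h /=.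
  by rewrite add0r (le_trans (ler_normD _ _)) //; lra.
have {}h3 : `|d * stein_deriv x y| <= d * 2.
  by rewrite normrM (gtr0_norm d0) ler_wpM2l // ltW.
rewrite (sl z zx) (sr (z + d)) ?(ltW xzd) //.
move: h1 h2 h3; rewrite slr !ler_norml => /andP[? ?] /andP[? ?] /andP[? ?].
move: nn; set Y := d * (d * (_ + _)) => nn; apply/andP; split; lra.
Qed.

End SteinDifference.

Section BerryEsseen.
Context {R : realType}.

Definition berry_const : R := mills_bound + 16.

(** Stein's method: by pbinom_steinE the distance from the normal distribution
    function is the mean of f'(Z) minus a leave-one-out mean of the difference
    quotients of f over steps of length 1/s. By stein_diff the two agree up to
    O((1 + |Z|)/s) and up to the probability that Z is next to x, which
    pbinom_point_le bounds by 1/s. *)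
Lemma pbinom_berry_esseen (ps : seq R) (x : R) : probs ps -> 1 <= pbinom_var ps ->
  `|pbinom ps (fun w => ((w%:R - pbinom_mean ps) / Num.sqrt (pbinom_var ps) <= x)%R%:R) - Phi x|
  <= berry_const / Num.sqrt (pbinom_var ps).
Proof.
move=> pps v1; set s := Num.sqrt _; set mu := pbinom_mean ps.
have mE := pbinom_is_mean pps.
have v0 : 0 < pbinom_var ps by rewrite (lt_le_trans ltr01).
have s1 : 1 <= s by rewrite -[leLHS]sqrtr1 ler_wsqrtr.
have s0 : 0 < s by rewrite (lt_le_trans ltr01).
have s_neq0 : s != 0 by rewrite gt_eqF.
have ss : s ^+ 2 = pbinom_var ps by rewrite sqr_sqrtr // ltW.
pose z (w : nat) : R := (w%:R - mu) / s.
pose d := s^-1.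
have d0 : 0 < d by rewrite invr_gt0.
have d1 : d <= 1 by rewrite invf_le1.
have zS w : z w.+1 = z w + d by rewrite /z /d -natr1; field.
have z_mono v w : (v <= w)%N -> z v <= z w.
  by move=> vw; rewrite ler_pM2r ?invr_gt0 // lerD2r ler_nat.
(* The intervals [z w, z w + d) are disjoint, so at most one of them contains x. *)
have [a aP] : exists a : nat, forall w, z w <= x < z w + d -> w = a.
  have [[a /andP[a1 a2]]|no] := pselect (exists w, z w <= x < z w + d).
    exists a => w /andP[w1 w2]; apply/eqP; rewrite eqn_leq; apply/andP; split.
      rewrite leqNgt; apply/negP => /z_mono; rewrite zS => h.
      by have := lt_le_trans a2 (le_trans h w1); rewrite ltxx.
    rewrite leqNgt; apply/negP => /z_mono; rewrite zS => h.
    by have := lt_le_trans w2 (le_trans h a1); rewrite ltxx.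
  by exists 0%N => w hw; case: no; exists w.
pose D w := stein_deriv x (z w).
pose F w := s * (stein x (z w.+1) - stein x (z w)).
pose E w := d * (mills_bound + 2 * `|z w| + 2) + 4 * (w == a)%:R.
(* E' dominates E at w and at w + 1, as pbinom_stein_le requires. *)
pose E' w := d * (mills_bound + 2 * `|z w| + 4) + 4 * ((w == a)%:R + (w == a.+1)%:R).
have K1 := @mills_bound_ge1 R.
have FD w y : z w <= y <= z w + d -> `|F w - stein_deriv x y| <= E w.
  move=> hy; rewrite -(ler_pM2l d0) -[X in X * `|_|](gtr0_norm d0) -normrM.
  have -> : d * (F w - stein_deriv x y) =
      stein x (z w + d) - stein x (z w) - d * stein_deriv x y.
    by rewrite /F zS /d; field.
  apply: (le_trans (stein_diff x d0 hy)); rewrite ler_pM2l //; apply: lerD.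
    rewrite ler_wpM2l ?(ltW d0) //.
    have : `|y| <= `|z w| + `|y - z w| by rewrite -{1}[y](subrK (z w)) [leRHS]addrC ler_normD.
    have : `|y - z w| <= 1 by case/andP: hy => *; rewrite ler_norml; lra.
    lra.
  rewrite ler_wpM2l // ler_nat.
  by case: (boolP (_ <= x < _)) => // /aP ->; rewrite eqxx.
have FD0 w : `|F w - D w| <= E w by apply: FD; rewrite lexx lerDl ltW.
have FD1 w : `|F w - D w.+1| <= E w by apply: FD; rewrite zS lexx lerDl ltW.
have main : pbinom_var ps * (pbinom ps (fun w => (z w <= x)%R%:R) - Phi x) =
    pbinom_var ps * pbinom ps D - pbinom_stein ps F.
  have -> : pbinom_stein ps F = pbinom_var ps * pbinom ps (fun w => z w * stein x (z w)).
    have := pbinom_steinE (fun w => s * stein x (z w)) pps.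
    rewrite -/mu (_ : pbinom_stein ps _ = pbinom_stein ps F); last first.
      by apply: eq_mean => w; rewrite /F mulrBr.
    move=> <-; rewrite -ss -(meanZ mE); apply: eq_mean => w.
    by rewrite /z; field.
  rewrite -mulrBr -(meanB mE) -[Phi x in LHS](mean_cst mE) -(meanB mE).
  by congr (_ * _); apply: eq_mean => w; rewrite /D /stein_deriv; ring.
have up : pbinom_var ps * pbinom ps D <= pbinom_stein ps F + pbinom_stein ps E.
  have := @pbinom_stein_lin R ps 1 F E pps; rewrite mul1r => <-.
  apply: pbinom_stein_ge => // w; rewrite mul1r.
    by have := FD0 w; rewrite ler_norml; lra.
  by have := FD1 w; rewrite ler_norml; lra.
have lo : pbinom_stein ps F - pbinom_stein ps E <= pbinom_var ps * pbinom ps D.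
  have := @pbinom_stein_lin R ps (-1) F E pps; rewrite mulN1r => <-.
  apply: pbinom_stein_le => // w; rewrite mulN1r.
    by have := FD0 w; rewrite ler_norml; lra.
  by have := FD1 w; rewrite ler_norml; lra.
have LE : pbinom_stein ps E <= pbinom_var ps * pbinom ps E'.
  apply: pbinom_stein_le => // w; rewrite /E /E'; apply: lerD.
  - by rewrite ler_wpM2l ?(ltW d0) //; lra.
  - by rewrite ler_wpM2l // lerDl.
  - rewrite ler_wpM2l ?(ltW d0) // zS.
    have : `|z w| <= `|z w + d| + `|d| by rewrite -{1}[z w](addrK d) ler_normB.
    rewrite (gtr0_norm d0); lra.
  - by rewrite ler_wpM2l // eqSS lerDr.
have point b : pbinom ps (fun w => (w == b)%:R) <= d.
  by rewrite -[d]mul1r ler_pdivlMr // mulrC pbinom_point_le.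
have abs1 : pbinom ps (fun w => `|z w|) <= 1.
  have := mean_CauchySchwarz mE (fun w => `|z w|) (fun=> 1).
  rewrite (@eq_mean _ _ _ _ (fun w => `|z w|)); last by move=> w; rewrite mulr1.
  have -> : pbinom ps (fun w => `|z w| ^+ 2) = 1.
    rewrite (@eq_mean _ _ _ _ (fun w => (pbinom_var ps)^-1 * (w%:R - mu) ^+ 2)).
      by rewrite (meanZ mE) pbinom_varE // mulVf // gt_eqF.
    by move=> w; rewrite real_normK ?num_real // -ss /z; field.
  rewrite expr1n (mean_cst mE) sqrtr1 mulr1; exact/le_trans/ler_norm.
have E'le : pbinom ps E' <= berry_const * d.
  rewrite /E' (@eq_mean _ _ _ _ (fun w => (d * (mills_bound + 4) + (2 * d) * `|z w|) +
      (4 * (w == a)%:R + 4 * (w == a.+1)%:R))); last by move=> w; ring.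
  rewrite !(meanD mE) (mean_cst mE) !(meanZ mE) /berry_const.
  by have := point a; have := point a.+1; nra.
rewrite -(ler_pM2l v0) -[X in X * `|_|](gtr0_norm v0) -normrM main.
apply: (@le_trans _ _ (pbinom_stein ps E)).
  by rewrite ler_norml; lra.
by rewrite (le_trans LE) // ler_pM2l.
Qed.

End BerryEsseen.

(** * The shuffled deck as a Markov chain *)

Section Dealing.
Context {R : realType} {n : nat} (m : 'I_n -> nat).
Implicit Types (h u : seq 'I_n) (F G : seq 'I_n -> R).
Local Notation N := (ncards m).

Definition valid h := [forall i, count_mem i h <= m i]%N.

(** The expectation of F over the first j cards: given the history h, the next card
    has type i with probability proportional to the number of cards of type i
    that remain. *)
Fixpoint deal (j : nat) F : R :=
  if j is j'.+1 then
    deal j' (fun h => \sum_i (remaining m h i)%:R / (N - j')%:R * F (rcons h i))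
  else F [::].

Lemma sum_remaining h : valid h -> (\sum_i remaining m h i = N - size h)%N.
Proof.
move=> /forallP vh.
rewrite /remaining sumnB //; congr (_ - _)%N.
rewrite -sum1_size [RHS](partition_big id predT) //=.
by apply: eq_bigr => i _; rewrite -sum1_count; apply: eq_bigl => k.
Qed.

Lemma sum_weights1 j h : (j < N)%N -> size h = j -> valid h ->
  \sum_i (remaining m h i)%:R / (N - j)%:R = 1 :> R.
Proof.
move=> jN hj vh; rewrite -mulr_suml -natr_sum sum_remaining // hj mulfV //.
by rewrite pnatr_eq0 -lt0n subn_gt0.
Qed.

Lemma valid_rcons h i : valid h -> (0 < remaining m h i)%N -> valid (rcons h i).
Proof.
move=> /forallP vh; rewrite subn_gt0 => hi; apply/forallP => k.
rewrite -cats1 count_cat /= addn0.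
by have [<-|] := eqVneq i k; rewrite ?addn1 // addn0.
Qed.

Lemma remaining_rcons h i k :
  remaining m (rcons h i) k = (remaining m h k - (i == k))%N.
Proof. by rewrite /remaining -cats1 count_cat /= addn0 subnDA. Qed.

(** A type with no card left has weight 0, so only histories that use no type more
    often than its multiplicity carry mass. *)
Lemma eq_deal j F G : (forall h, size h = j -> valid h -> F h = G h) ->
  deal j F = deal j G.
Proof.
elim: j F G => [|j IH] F G FG /=.
  by apply: FG => //; apply/forallP => i.
apply: IH => h hj vh; apply: eq_bigr => i _.
have [->|r0] := posnP (remaining m h i); first by rewrite !mul0r.
by rewrite FG // ?size_rcons ?hj // valid_rcons.
Qed.

Lemma deal_is_mean j : (j <= N)%N -> is_mean (deal j).
Proof.
move=> jN; split.
- elim: j {jN} => //= j IH F G; rewrite -IH; congr deal; apply/funext => h.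
  by rewrite -big_split; apply: eq_bigr => i _; rewrite /= mulrDr.
- elim: j {jN} => //= j IH c F; rewrite -IH; congr deal; apply/funext => h.
  by rewrite mulr_sumr; apply: eq_bigr => i _; rewrite mulrCA.
- elim: j {jN} => //= j IH F F0; apply: IH => h; apply: sumr_ge0 => i _.
  by rewrite mulr_ge0 // divr_ge0.
- elim: j jN => //= j IH jN; rewrite -[RHS](IH (ltnW jN)); apply: eq_deal => h hj vh.
  by under eq_bigr do rewrite mulr1; exact: sum_weights1.
Qed.

Lemma deal_step j F : (j < N)%N -> deal j.+1 F =
  deal j (fun h => \sum_i (remaining m h i)%:R / (N - j)%:R * F (rcons h i)).
Proof. by []. Qed.

(** Chain rule for the probability of a given history: the factors in the
    numerators multiply to falling factorials of the multiplicities. *)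
Lemma deal_point u : (size u <= N)%N ->
  (N ^_ (size u))%:R * deal (size u) (fun h => (h == u)%:R) =
  (\prod_i m i ^_ (count_mem i u))%:R :> R.
Proof.
elim/last_ind: u => [_|u i IH].
  by rewrite /= ffactn0 mulr1 big1 // => i _; rewrite ffactn0.
rewrite size_rcons => uN /=.
have mE := deal_is_mean (ltnW uN).
have -> : deal (size u) (fun h => \sum_k (remaining m h k)%:R / (N - size u)%:R *
    (rcons h k == rcons u i)%:R) =
    (remaining m u i)%:R / (N - size u)%:R * deal (size u) (fun h => (h == u)%:R).
  rewrite -(meanZ mE); apply: eq_mean => h.
  rewrite (bigD1 i) //= eqseq_rcons eqxx andbT big1 ?addr0 => [|k ki].
    by have [->|] := eqVneq h u; rewrite ?mulr0.
  by rewrite eqseq_rcons (negbTE ki) andbF mulr0.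
rewrite ffactnSr natrM.
have Nu : (N - size u)%:R != 0 :> R by rewrite pnatr_eq0 -lt0n subn_gt0.
have -> : (N ^_ size u)%:R * (N - size u)%:R * ((remaining m u i)%:R / (N - size u)%:R *
    deal (size u) (fun h => (h == u)%:R)) =
  (remaining m u i)%:R * ((N ^_ size u)%:R * deal (size u) (fun h => (h == u)%:R)) :> R.
  by field.
rewrite IH ?(ltnW uN) // -natrM; congr (_%:R).
rewrite (bigD1 i) //= [in RHS](bigD1 i) //= mulnA; congr (_ * _)%N.
  by rewrite -cats1 count_cat /= eqxx addn1 ffactnSr mulnC.
by apply: eq_bigr => k ki; rewrite -cats1 count_cat /= [i == k]eq_sym (negbTE ki) !addn0.
Qed.

Lemma valid_full h : size h = N -> valid h -> [forall i, count_mem i h == m i].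
Proof.
move=> hN vh; have := sum_remaining vh; rewrite hN subnn => /eqP.
rewrite sum_nat_eq0 => /forallP r0; apply/forallP => i.
by rewrite eqn_leq (forallP vh i) /= -subn_eq0; exact: (implyP (r0 i)).
Qed.

(** The probability of a complete arrangement depends only on its counts, which all
    arrangements share, so the law is uniform. *)
Lemma deal_full F : deal N F =
  (#|{: arrangement m}|%:R)^-1 * \sum_(w : arrangement m) F (cards w).
Proof.
have mE := deal_is_mean (leqnn N).
pose k : R := (\prod_i (m i)`!)%:R / (N`!)%:R.
have point (w : arrangement m) : deal N (fun h => (h == cards w)%:R) = k.
  have N0 : (N`!)%:R != 0 :> R by rewrite pnatr_eq0 -lt0n fact_gt0.
  apply: (mulfI N0); rewrite /k mulrCA mulfV // mulr1.
  have sw : size (cards w) = N by rewrite size_tuple.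
  have := @deal_point (cards w); rewrite sw ffactnn => ->; last exact: leqnn.
  congr (_%:R).
  by apply: eq_bigr => i _; case: w {sw} => w /= /forallP /(_ i) /eqP ->; rewrite ffactnn.
have expand G : deal N G = k * \sum_(w : arrangement m) G (cards w).
  transitivity (deal N (fun h => \sum_(w : arrangement m) G (cards w) * (h == cards w)%:R)).
    apply: eq_deal => h hN vh.
    have hs : size h == N by rewrite hN.
    pose w0 := @Arrangement n m (Tuple hs) (valid_full hN vh).
    rewrite (bigD1 w0) //= eqxx mulr1 big1 ?addr0 // => w ww0.
    have [hw|_] := eqVneq h (cards w); last by rewrite mulr0.
    by case/eqP: ww0; apply: val_inj; apply: val_inj; rewrite /= hw.
  rewrite (mean_sum mE) mulr_sumr; apply: eq_bigr => w _.
  by rewrite (meanZ mE) point mulrC.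
rewrite expand; congr (_ * _).
have := expand (fun=> 1); rewrite (mean1 mE) sumr_const => h1.
have c0 : #|{: arrangement m}|%:R != 0 :> R.
  by apply/eqP => c0; move: h1; rewrite c0 mulr0 => /eqP; rewrite oner_eq0.
by apply: (mulIf c0); rewrite mulVf.
Qed.

End Dealing.

Section Shuffle.
Context {R : realType} {n : nat} (m : 'I_n -> nat).
Local Notation P := (shuffle R m).

Lemma shuffle_set1 (w : arrangement m) : P [set w] = ((#|{: arrangement m}|%:R)^-1)%:E.
Proof.
rewrite /shuffle /mscale /= /counting asboolT; last exact: finite_set1.
by rewrite fset_set1 cardfs1 mule1.
Qed.

Lemma expectation_shuffle (X : arrangement m -> R) :
  'E_P[X]%E = ((#|{: arrangement m}|%:R)^-1 * \sum_(w : arrangement m) X w)%:E.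
Proof.
have mX (Y : arrangement m -> R) : measurable_fun setT Y by [].
have iX (v : arrangement m) : P.-integrable setT (EFin \o (fun w => X v * \1_[set v] w)).
  have i1 : P.-integrable setT (fun w => (\1_[set v] w)%:E) by exact: integrable_indic.
  exact: (integrableZl measurableT (X v) i1).
rewrite unlock.
transitivity (\int[P]_w (\sum_(v : arrangement m) (X v * \1_[set v] w)%:E)%E)%E.
  apply: eq_integral => w _; rewrite sumEFin (bigD1 w) //= big1 ?addr0.
    by rewrite indicE mem_set // mulr1.
  by move=> v vw; rewrite indicE memNset ?mulr0 // => /= wv; rewrite wv eqxx in vw.
rewrite integral_sum //.
rewrite mulr_sumr -sumEFin; apply: eq_bigr => v _.
under eq_integral do rewrite EFinM.
rewrite integralZl //; last exact: integrable_indic.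
by rewrite integral_indic // setIT mulrC EFinM; congr (_ * _)%E; exact: shuffle_set1.
Qed.

Lemma expectation_deal (F : seq 'I_n -> R) :
  'E_P[fun w => F (cards w)]%E = (deal m (ncards m) F)%:E.
Proof. by rewrite expectation_shuffle deal_full. Qed.

Lemma shuffle_deal (Q : pred (seq 'I_n)) :
  P [set w | Q (cards w)] = (deal m (ncards m) (fun h => (Q h)%:R))%:E.
Proof.
rewrite -expectation_deal -(expectation_indic P) //; congr expectation.
apply/funext => w; rewrite indicE.
by case: (boolP (Q (cards w))) => q; [rewrite mem_set | rewrite memNset //; exact/negP].
Qed.

(** The number of correct guesses along a history; onth makes sense also for
    n = 0, where there is no default type. *)
Definition hits (g : strategy n) (h : seq 'I_n) : nat :=
  (\sum_(k < size h) (g (take k h) == onth h k))%N.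

Lemma hits_rcons g h i : hits g (rcons h i) = (hits g h + (g h == Some i))%N.
Proof.
rewrite /hits size_rcons big_ord_recr /=; congr (_ + _)%N.
  apply: eq_bigr => k _; rewrite -cats1 takel_cat ?(ltnW (ltn_ord k)) //.
  by rewrite onth_cat ltn_ord.
by rewrite -cats1 take_size_cat // onth_cat ltnn subnn.
Qed.

Lemma scoreE g (w : arrangement m) : score R m g w = (hits g (cards w))%:R.
Proof.
rewrite /score /hits size_tuple; congr (_%:R); apply: eq_bigr => k _.
by rewrite onthE (nth_map (tnth w k)) ?size_tuple // -tnth_nth eq_sym.
Qed.

Lemma score_meanE g : score_mean R m g = deal m (ncards m) (fun h => (hits g h)%:R).
Proof.
rewrite /score_mean (_ : score R m g = fun w => (hits g (cards w))%:R).
  by rewrite (expectation_deal (fun h => (hits g h)%:R)).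
by apply/funext => w; rewrite scoreE.
Qed.

Lemma score_varE g : score_var R m g =
  deal m (ncards m) (fun h => ((hits g h)%:R - score_mean R m g) ^+ 2).
Proof.
pose F h : R := ((hits g h)%:R - score_mean R m g) ^+ 2.
rewrite /score_var /variance covariance.unlock.
set X := (X in fine 'E_P[X]%E).
have -> : X = fun w => F (cards w).
  by apply/funext => w; rewrite /X /F /score_mean -scoreE expr2.
by rewrite (expectation_deal F).
Qed.

End Shuffle.

(** * Surviving sets of equal cards *)

Section Bernoulli.
Context {R : realType}.
Implicit Types x t : R.

Lemma bernoulli_ineq x k : -1 <= x -> 1 + k%:R * x <= (1 + x) ^+ k.
Proof.
move=> x1; elim: k => [|k IH]; first by rewrite mul0r addr0.
have h0 : 0 <= 1 + x by lra.
rewrite exprSr; apply: le_trans (ler_wpM2r h0 IH).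
have k0 : 0 <= k%:R :> R by [].
have := sqr_ge0 x; rewrite expr2 -natr1; nra.
Qed.

(** With x = 1 / (t - k + 1), the claim is (1 - x)^(k-1) (1 + (k-1) x) <= 1, which
    follows from Bernoulli's inequality and (1 - x)(1 + x) <= 1. *)
Lemma thinning_ge (k : nat) t : k.+1%:R <= t ->
  ((t - k%:R) / (t - k%:R + 1)) ^+ k <= 1 - k%:R / t.
Proof.
case: k => [|k] kt; first by rewrite expr0 mul0r subr0.
pose x := (t - k%:R)^-1.
have tk : 1 < t - k%:R by move: kt; rewrite -!natr1; lra.
have tk_neq : t - k%:R != 0 by rewrite gt_eqF //; lra.
have t0 : t != 0 by rewrite gt_eqF //; have : 0 <= k%:R :> R by []; lra.
have x0 : 0 < x by rewrite invr_gt0; lra.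
have x1 : x <= 1 by rewrite invf_le1; lra.
have -> : (t - k.+1%:R) / (t - k.+1%:R + 1) = 1 - x.
  by rewrite -natr1 (_ : t - _ + 1 = t - k%:R); [rewrite /x; field | ring].
have y0 : 0 < 1 + k%:R * x by rewrite ltr_pwDl // mulr_ge0 // ltW.
have -> : 1 - k.+1%:R / t = (1 - x) / (1 + k%:R * x).
  rewrite -natr1 /x; field. rewrite tk_neq /= subrK.
  done.
rewrite exprS ler_wpM2l ?subr_ge0 //.
rewrite -[leRHS]mul1r ler_pdivlMr //.
apply: (@le_trans _ _ ((1 - x) ^+ k * (1 + x) ^+ k)).
  by rewrite ler_wpM2l ?exprn_ge0 ?subr_ge0 // bernoulli_ineq //; lra.
rewrite -exprMn exprn_ile1 //; nra.
Qed.

End Bernoulli.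

Section Remaining.
Context {R : realType} {n : nat} (m : 'I_n -> nat).
Local Notation N := (ncards m).
Local Notation deal := (@deal R n m).
Local Notation rem := (remaining m).
Implicit Types (h : seq 'I_n) (l : 'I_n) (j k t : nat).

Definition top h : nat := (\max_i rem h i)%N.

(** One transition lowers a single multiplicity by one, so a function of two
    multiplicities changes by a on drawing l and by b on drawing l'. *)
Lemma sum_weights h (G : 'I_n -> R) (A a b : R) l l' j :
  (j < N)%N -> size h = j -> valid m h -> l != l' ->
  (forall i, G i = A - (i == l)%:R * a - (i == l')%:R * b) ->
  \sum_i (rem h i)%:R / (N - j)%:R * G i =
  A - (rem h l)%:R / (N - j)%:R * a - (rem h l')%:R / (N - j)%:R * b.
Proof.
move=> jN hj vh ll' GE.
have s1 := @sum_weights1 R n m j h jN hj vh.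
have pick (k : 'I_n) (c : R) : \sum_i (rem h i)%:R / (N - j)%:R * ((i == k)%:R * c) =
    (rem h k)%:R / (N - j)%:R * c.
  rewrite (bigD1 k) //= eqxx mul1r big1 ?addr0 // => i ik.
  by rewrite (negbTE ik) mul0r mulr0.
have -> : A = \sum_i (rem h i)%:R / (N - j)%:R * A by rewrite -mulr_suml s1 mul1r.
rewrite -!pick -!sumrB; apply: eq_bigr => i _.
by rewrite GE; ring.
Qed.

Lemma bin_pred r k : r%:R * ('C(r, k)%:R - 'C(r.-1, k)%:R) = k%:R * 'C(r, k)%:R :> R.
Proof.
case: r => [|r]; first by rewrite mul0r; case: k => [|k]; rewrite ?mul0r // bin0n mulr0.
case: k => [|k]; first by rewrite !bin0 subrr mul0r mulr0.
have e : 'C(r.+1, k.+1)%:R = 'C(r, k.+1)%:R + 'C(r, k)%:R :> R by rewrite binS natrD.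
by rewrite -[RHS]natrM -mul_bin_diag natrM e /=; ring.
Qed.

(** A fixed k-subset of the remaining cards is hit by the next card with
    probability k divided by the number of cards left. *)
Lemma deal_bin_step j l k : (j < N)%N ->
  deal j.+1 (fun h => 'C(rem h l, k)%:R) =
  (1 - k%:R / (N - j)%:R) * deal j (fun h => 'C(rem h l, k)%:R).
Proof.
move=> jN; have mE := @deal_is_mean R n m j (ltnW jN).
rewrite deal_step // -(meanZ mE); apply: eq_deal => h hj vh.
have s1 := @sum_weights1 R n m j h jN hj vh.
transitivity (\sum_i (rem h i)%:R / (N - j)%:R * ('C(rem h l, k)%:R) -
   (rem h l)%:R / (N - j)%:R * ('C(rem h l, k)%:R - 'C((rem h l).-1, k)%:R) : R).
  rewrite [in RHS](bigD1 l) //= [in LHS](bigD1 l) //= remaining_rcons eqxx subn1.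
  rewrite (eq_bigr (fun i => (rem h i)%:R / (N - j)%:R * 'C(rem h l, k)%:R : R)); first ring.
  by move=> i il; rewrite remaining_rcons (negbTE il) subn0.
rewrite -mulr_suml s1 mul1r mulrBl mul1r; congr (_ - _).
by rewrite mulrAC bin_pred mulrAC.
Qed.

Lemma deal_bin2_step j l l' k : (j < N)%N -> l != l' ->
  deal j.+1 (fun h => 'C(rem h l, k)%:R * 'C(rem h l', k)%:R) =
  (1 - 2 * k%:R / (N - j)%:R) * deal j (fun h => 'C(rem h l, k)%:R * 'C(rem h l', k)%:R).
Proof.
move=> jN ll'; have mE := @deal_is_mean R n m j (ltnW jN).
rewrite deal_step // -(meanZ mE); apply: eq_deal => h hj vh.
rewrite (@sum_weights h _ ('C(rem h l, k)%:R * 'C(rem h l', k)%:R)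
  (('C(rem h l, k)%:R - 'C((rem h l).-1, k)%:R) * 'C(rem h l', k)%:R)
  ('C(rem h l, k)%:R * ('C(rem h l', k)%:R - 'C((rem h l').-1, k)%:R)) l l') //; last first.
  move=> i; rewrite !remaining_rcons.
  have [->|il] := eqVneq i l; first by rewrite (negbTE ll') subn0 subn1 /=; ring.
  by have [_|_] := eqVneq i l'; rewrite subn0 ?subn1 ?subn0 /=; ring.
have e1 := bin_pred (rem h l) k; have e2 := bin_pred (rem h l') k.
transitivity ('C(rem h l, k)%:R * 'C(rem h l', k)%:R
 - (rem h l)%:R * ('C(rem h l, k)%:R - 'C((rem h l).-1, k)%:R) / (N - j)%:R * 'C(rem h l', k)%:R
 - (rem h l')%:R * ('C(rem h l', k)%:R - 'C((rem h l').-1, k)%:R) / (N - j)%:R *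
   'C(rem h l, k)%:R : R); first by ring.
by rewrite e1 e2; ring.
Qed.

(** The probability that k given cards all survive the first j draws. *)
Definition survival k j : R := \prod_(i < j) (1 - k%:R / (N - i)%:R).

Lemma deal_bin j l k : (j <= N)%N ->
  deal j (fun h => 'C(rem h l, k)%:R) = 'C(m l, k)%:R * survival k j.
Proof.
elim: j => [|j IH] jN; first by rewrite /= /survival big_ord0 mulr1 /remaining subn0.
by rewrite deal_bin_step // IH ?(ltnW jN) // /survival big_ord_recr /=; ring.
Qed.

(** Negative correlation: two disjoint k-subsets survive a draw with factor
    1 - 2x, which is at most (1 - x)^2 with x = k / (cards left). *)
Lemma deal_bin2_le j l l' k : (j <= N)%N -> l != l' ->
  deal j (fun h => 'C(rem h l, k)%:R * 'C(rem h l', k)%:R) <=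
  'C(m l, k)%:R * 'C(m l', k)%:R * survival k j ^+ 2.
Proof.
move=> + ll'; elim: j => [|j IH] jN.
  by rewrite /= /survival big_ord0 expr1n mulr1 /remaining !subn0.
have mE := @deal_is_mean R n m j (ltnW jN).
rewrite deal_bin2_step //.
rewrite /survival big_ord_recr /= -/(survival k j) exprMn mulrA [leRHS]mulrC.
set x := k%:R / (N - j)%:R.
apply: (@le_trans _ _ ((1 - x) ^+ 2 * deal j (fun h => 'C(rem h l, k)%:R * 'C(rem h l', k)%:R))).
  rewrite ler_wpM2r //; first by apply: (mean_ge0 mE) => h; rewrite mulr_ge0.
  by rewrite -mulrA -/x; have := sqr_ge0 x; nra.
by rewrite ler_wpM2l ?sqr_ge0 // IH // ltnW.
Qed.

(** The number of k-subsets of equal cards in the remaining deck. It is positive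
    exactly when some type has at least k cards left. *)
Definition ksets k h : R := \sum_l 'C(rem h l, k)%:R.

Lemma deal_ksets j k : (j <= N)%N ->
  deal j (ksets k) = (\sum_l 'C(m l, k)%:R) * survival k j.
Proof.
move=> jN; have mE := @deal_is_mean R n m j jN.
by rewrite (mean_sum mE) mulr_suml; apply: eq_bigr => l _; rewrite deal_bin.
Qed.

(** Second moment: pairs of subsets of different types are negatively correlated,
    and pairs of the same type contribute at most B times the mean. *)
Lemma deal_ksets_var j k (B : R) : (j <= N)%N -> (forall l, 'C(m l, k)%:R <= B) ->
  deal j (fun h => (ksets k h - deal j (ksets k)) ^+ 2) <= B * deal j (ksets k).
Proof.
move=> jN mB; have mE := @deal_is_mean R n m j jN.
have -> : deal j (fun h => (ksets k h - deal j (ksets k)) ^+ 2) =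
    deal j (fun h => ksets k h ^+ 2) - deal j (ksets k) ^+ 2.
  set e := deal j (ksets k).
  rewrite (@eq_mean _ _ (deal j) _ (fun h => ksets k h ^+ 2 + ((- 2 * e) * ksets k h + e ^+ 2))).
    by rewrite !(meanD mE) (meanZ mE) (mean_cst mE) -/e; ring.
  by move=> h; ring.
rewrite lerBlDr.
have -> : (fun h => ksets k h ^+ 2) = (fun h => \sum_l ('C(rem h l, k)%:R ^+ 2 +
    \sum_(l' | l' != l) 'C(rem h l, k)%:R * 'C(rem h l', k)%:R)).
  apply/funext => h; rewrite expr2 {1}/ksets mulr_suml; apply: eq_bigr => l _.
  by rewrite /ksets (bigD1 l) //= mulrDr expr2 mulr_sumr.
rewrite (mean_sum mE).
have -> : B * deal j (ksets k) + deal j (ksets k) ^+ 2 =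
  \sum_l (B * deal j (fun h => 'C(rem h l, k)%:R) +
    \sum_l' ('C(m l, k)%:R * 'C(m l', k)%:R * survival k j ^+ 2)).
  rewrite big_split /= -mulr_sumr -(mean_sum mE) -/(ksets k); congr (_ + _).
  rewrite deal_ksets // exprMn expr2 -mulrA mulr_suml; apply: eq_bigr => l _.
  by rewrite mulr_suml mulr_sumr; apply: eq_bigr => l' _; rewrite mulrA.
apply: ler_sum => l _; rewrite (meanD mE); apply: lerD.
  rewrite -(meanZ mE); apply: (ler_mean mE) => h; rewrite expr2 ler_wpM2r //.
  by rewrite (le_trans _ (mB l)) // ler_nat leq_bin2l // leq_subr.
rewrite (mean_sum mE) [leRHS](bigD1 l) //= ler_wpDl ?(mulr_ge0 _ (sqr_ge0 _)) ?mulr_ge0 //.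
by apply: ler_sum => l' ll'; rewrite deal_bin2_le // eq_sym.
Qed.

Lemma top_ksets k h : (0 < k)%N -> ((k <= top h)%N)%:R <= ksets k h.
Proof.
move=> k0; have [kt|_] := leqP k (top h); last by rewrite sumr_ge0.
have [l kl] : exists l, (k <= rem h l)%N.
  apply/existsP; apply: contraTT kt; rewrite negb_exists -ltnNge => /forallP hl.
  rewrite -(prednK k0) ltnS; apply/bigmax_leqP => l _.
  by rewrite -ltnS prednK // ltnNge hl.
rewrite /ksets (bigD1 l) //= ler_wpDr ?sumr_ge0 // ler1n bin_gt0 //.
Qed.

Lemma top_ksets0 k h : (top h < k)%N -> ksets k h = 0.
Proof.
move=> tk; rewrite /ksets big1 // => l _; rewrite bin_small //.
by rewrite (leq_ltn_trans _ tk) // (leq_bigmax l).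
Qed.

Lemma top_prob_le j k : (j <= N)%N -> (0 < k)%N ->
  deal j (fun h => ((k <= top h)%N)%:R) <= deal j (ksets k).
Proof.
move=> jN k0; have mE := @deal_is_mean R n m j jN.
by apply: (ler_mean mE) => h; exact: top_ksets.
Qed.

(** Chebyshev's inequality: if no type has k cards left, then the number of k-subsets
    is 0, which is a deviation by its mean. *)
Lemma top_prob_ge j k (B : R) : (j <= N)%N -> (forall l, 'C(m l, k)%:R <= B) ->
  0 < deal j (ksets k) ->
  1 - deal j (fun h => ((k <= top h)%N)%:R) <= B / deal j (ksets k).
Proof.
move=> jN mB; set e := deal j _ => e0; have mE := @deal_is_mean R n m j jN.
rewrite ler_pdivlMr // -(ler_pM2r e0) -mulrA -expr2.
apply: le_trans (deal_ksets_var jN mB); rewrite -/e.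
rewrite -[X in X - deal _ _](mean1 mE) -(meanB mE) mulrC -(meanZ mE); apply: (ler_mean mE) => h.
have [kt|tk] := leqP k (top h); first by rewrite /= subrr mulr0 sqr_ge0.
by rewrite top_ksets0 // subr0 mulr1 sub0r sqrrN.
Qed.

(** Each draw multiplies the mean by 1 - k/t <= (1 - 1/t)^k, and the product of the
    factors 1 - 1/t telescopes. *)
Lemma deal_ksets_le j k : (j <= N)%N -> (0 < N)%N ->
  deal j (ksets k) <= (\sum_l 'C(m l, k)%:R) * ((N - j)%:R / N%:R) ^+ k.
Proof.
move=> + N0; have N0' : N%:R != 0 :> R by rewrite pnatr_eq0 -lt0n.
elim: j => [|j IH] jN.
  by rewrite deal_ksets // /survival big_ord0 subn0 divff // expr1n.
have mE := @deal_is_mean R n m j (ltnW jN).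
have t0 : 0 < (N - j)%:R :> R by rewrite ltr0n subn_gt0.
have -> : deal j.+1 (ksets k) = (1 - k%:R / (N - j)%:R) * deal j (ksets k).
  rewrite !deal_ksets ?(ltnW jN) // /survival big_ord_recr /=; ring.
have -> : (N - j.+1)%:R / N%:R = (1 - (N - j)%:R^-1) * ((N - j)%:R / N%:R) :> R.
  have -> : (N - j.+1)%:R = (N - j)%:R - 1 :> R by rewrite subnS -subn1 natrB // subn_gt0.
  by field; rewrite N0' gt_eqF.
rewrite exprMn mulrCA; set c := (1 - (N - j)%:R^-1) ^+ k.
apply: (@le_trans _ _ (c * deal j (ksets k))).
  rewrite ler_wpM2r //.
    by apply: (mean_ge0 mE) => h; rewrite /ksets sumr_ge0.
  apply: le_trans (bernoulli_ineq _ _); first by rewrite mulrN.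
  by rewrite lerN2 invf_le1 // ler1n subn_gt0.
rewrite ler_wpM2l // ?IH ?(ltnW jN) // exprn_ge0 // subr_ge0.
by rewrite invf_le1 // ler1n subn_gt0.
Qed.

Lemma survival_ge j k : (j + k <= N)%N ->
  (((N - j)%:R - k%:R + 1) / (N%:R - k%:R + 1)) ^+ k <= survival k j.
Proof.
elim: j => [|j IH] jN.
  rewrite /survival big_ord0 subn0 divff ?expr1n // gt_eqF //.
  by rewrite ltr_wpDl // subr_ge0 ler_nat.
rewrite addSn in jN.
have jN' : (j < N)%N by rewrite (leq_trans _ jN) // ltnS leq_addr.
rewrite /survival big_ord_recr /= -/(survival k j).
have kt : k.+1%:R <= (N - j)%:R :> R by rewrite ler_nat; lia.
have tk : 1 <= (N - j)%:R - k%:R :> R by rewrite lerBrDr addrC natr1.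
have Nk : 1 <= N%:R - k%:R :> R.
  by rewrite lerBrDr addrC natr1 ler_nat; lia.
have -> : (N - j.+1)%:R = (N - j)%:R - 1 :> R by rewrite subnS -subn1 natrB // subn_gt0.
have -> : ((N - j)%:R - 1 - k%:R + 1) / (N%:R - k%:R + 1) =
   ((N - j)%:R - k%:R + 1) / (N%:R - k%:R + 1) *
     (((N - j)%:R - k%:R) / ((N - j)%:R - k%:R + 1)) :> R.
  by field; rewrite !gt_eqF //; lra.
rewrite exprMn; apply: ler_pM.
- by rewrite exprn_ge0 // divr_ge0 //; lra.
- by rewrite exprn_ge0 // divr_ge0 //; lra.
- exact: IH (ltnW jN).
- exact: thinning_ge kt.
Qed.

End Remaining.

(** * Harmonic sums *)

Section Sums.
Context {R : realType}.
Implicit Types (T : R) (N : nat).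

Lemma sum_inv_sqr_le N : \sum_(t < N) (t.+1%:R ^+ 2)^-1 <= 2 :> R.
Proof.
apply: (@le_trans _ _ (2 - 2 / N.+1%:R)); last by rewrite gerBl divr_ge0.
elim: N => [|N IH]; first by rewrite big_ord0 invr1 mulr1 subrr.
rewrite big_ord_recr /=; apply: (le_trans (lerD IH (lexx _))).
have N0 : 0 <= N%:R :> R by [].
rewrite -!natr1; set x : R := N%:R in N0 *.
rewrite -subr_ge0 (_ : _ - _ = x / ((x + 1) ^+ 2 * (x + 1 + 1))).
  by rewrite divr_ge0 // mulr_ge0 ?sqr_ge0 //; lra.
by field; rewrite !gt_eqF //; lra.
Qed.

Definition min_inv (x : R) := Num.min x x^-1.

Lemma min_inv_ge0 x : 0 <= x -> 0 <= min_inv x.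
Proof. by move=> x0; rewrite le_min x0 invr_ge0. Qed.

(** Below T the terms are at most 1/T, above T they are at most T/t^2; both parts
    have bounded sums. *)
Lemma sum_min_inv_le T N : 1 <= T -> \sum_(t < N) min_inv (t.+1%:R / T) / t.+1%:R <= 4.
Proof.
move=> T1; have T0 : 0 < T by lra.
have small M : \sum_(t < M) min_inv (t.+1%:R / T) / t.+1%:R <= M%:R / T.
  elim: M => [|M IH]; first by rewrite big_ord0 mul0r.
  rewrite big_ord_recr /=; apply: (@le_trans _ _ (M%:R / T + T^-1)); last first.
    by rewrite -natr1 mulrDl mul1r.
  apply: lerD => //.
  by rewrite ler_pdivrMr ?ltr0n // [leRHS]mulrC /min_inv ge_min lexx.
suff [le1 le2] : (N%:R < T -> \sum_(t < N) min_inv (t.+1%:R / T) / t.+1%:R <= 4) /\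
    (T <= N%:R -> \sum_(t < N) min_inv (t.+1%:R / T) / t.+1%:R <= 4 - 2 * T / N.+1%:R).
  have [TN|NT] := leP T N%:R; last exact: le1.
  by apply: (le_trans (le2 TN)); rewrite gerBl divr_ge0 ?mulr_ge0 // ltW.
split=> [NT|].
  by apply: (le_trans (small N)); rewrite ler_pdivrMr //; lra.
elim: N => [T0'|N IH TN1]; first by lra.
have N0 : 0 <= N%:R :> R by [].
have [TN|NT] := leP T N%:R.
  rewrite big_ord_recr /=; apply: (le_trans (lerD (IH TN) (lexx _))).
  suff : min_inv (N.+1%:R / T) / N.+1%:R <= 2 * T / N.+1%:R - 2 * T / N.+2%:R.
    by set a := 2 * T / N.+1%:R; set b := 2 * T / N.+2%:R; set c := min_inv _ / _; lra.
  apply: (@le_trans _ _ (T / N.+1%:R / N.+1%:R)).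
    by rewrite ler_pM2r ?invr_gt0 ?ltr0n // /min_inv ge_min invf_div lexx orbT.
  rewrite -!natr1; set x : R := N%:R in N0 *.
  rewrite -subr_ge0 (_ : _ - _ = T * x / ((x + 1) ^+ 2 * (x + 1 + 1))).
    by rewrite divr_ge0 ?mulr_ge0 ?sqr_ge0 ?(ltW T0) //; lra.
  by field; rewrite !gt_eqF //; lra.
apply: (le_trans (small N.+1)).
apply: (@le_trans _ _ 2); first by rewrite ler_pdivrMr // -natr1; lra.
have : T / N.+2%:R <= 1 by rewrite ler_pdivrMr ?ltr0n // mul1r -natr1; lra.
by rewrite -[2 * T / _]mulrA; set b := T / N.+2%:R; lra.
Qed.

Lemma ln_succ_le N : (0 < N)%N -> N.+1%:R^-1 <= ln N.+1%:R - ln N%:R :> R.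
Proof.
move=> N0; have N0' : 0 < N%:R :> R by rewrite ltr0n.
have h : ln (N%:R / N.+1%:R) <= - (N.+1%:R)^-1 :> R.
  have -> : N%:R / N.+1%:R = 1 + - (N.+1%:R)^-1 :> R.
    by rewrite -natr1; field; rewrite natr1 pnatr_eq0.
  by rewrite le_ln1Dx // ltrN2 invf_lt1 ?ltr1n ?ltr0n.
by move: h; rewrite ln_div ?posrE ?ltr0n //; set a := N.+1%:R^-1; lra.
Qed.

Lemma ln_succ_ge N : ln N.+2%:R - ln N.+1%:R <= N.+1%:R^-1 :> R.
Proof.
rewrite -ln_div ?posrE ?ltr0n //.
have -> : N.+2%:R / N.+1%:R = 1 + (N.+1%:R)^-1 :> R.
  by rewrite -natr1; field.
by rewrite le_ln1Dx // (lt_trans (ltrN10 _)) // invr_gt0 ltr0n.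
Qed.

Lemma harmonic_tail T N : 1 <= T -> T <= N%:R ->
  `|\sum_(t < N) (T <= t.+1%:R)%R%:R / t.+1%:R - (ln N%:R - ln T)| <= 2.
Proof.
move=> T1; have T0 : 0 < T by lra.
suff H : T <= N%:R -> ln N.+1%:R - ln T - 2 <=
    \sum_(t < N) (T <= t.+1%:R)%R%:R / t.+1%:R <= 1 + ln N%:R - ln T.
  move=> TN; have /andP[h1 h2] := H TN.
  have N0 : 0 < N%:R :> R by lra.
  have : ln N%:R <= ln N.+1%:R :> R.
    by rewrite ler_ln ?posrE ?N0 ?ler_nat ?leqnSn ?ltr0n.
  by rewrite ler_norml; lra.
elim: N => [T0'|N IH TN1]; first by lra.
rewrite big_ord_recr /= TN1 mul1r.
have [TN|NT] := leP T N%:R.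
  have N0 : (0 < N)%N by rewrite -(ltr_nat R); lra.
  have /andP[h1 h2] := IH TN; move: (ln_succ_le N0) (ln_succ_ge N).
  by set a := N.+1%:R^-1; lra.
rewrite big1 ?add0r => [|t _]; last first.
  rewrite leNgt (le_lt_trans _ NT) ?mul0r //.
  by rewrite ler_nat.
have N1 : N.+1%:R^-1 <= 1 :> R by rewrite invf_le1 ?ltr0n // ler1n.
have N1' : 0 <= N.+1%:R^-1 :> R by [].
have : ln T <= ln N.+1%:R by rewrite ler_ln ?posrE ?ltr0n.
have : ln N.+2%:R - ln T <= 2.
  rewrite -ln_div ?posrE ?ltr0n //.
  have h3 : N.+2%:R / T <= 3 by rewrite ler_pdivrMr // -!natr1; lra.
  apply: (@le_trans _ _ (ln (1 + 2))); last by rewrite le_ln1Dx //; lra.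
  rewrite ler_ln ?posrE ?divr_gt0 ?ltr0n //; lra.
by move: N1 N1'; set a := N.+1%:R^-1; lra.
Qed.

Lemma harmonic_ge N : ln N%:R - 2 <= \sum_(t < N) t.+1%:R^-1 :> R.
Proof.
case: N => [|N]; first by rewrite big_ord0 ln0 //; lra.
have := @harmonic_tail 1 N.+1 (lexx _); rewrite ler1n ltn0Sn ln1 subr0 => /(_ isT).
rewrite (eq_bigr (fun t : 'I_N.+1 => t.+1%:R^-1)).
  by rewrite ler_norml; lra.
by move=> t _; rewrite ler1n ltn0Sn mul1r.
Qed.

Lemma ln_le_sqrt (x : R) : 0 < x -> ln x <= 2 * Num.sqrt x.
Proof.
move=> x0; have s0 : 0 < Num.sqrt x by rewrite sqrtr_gt0.
have := ln_sublinear s0.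
by rewrite -{3}(sqr_sqrtr (ltW x0)) lnXn // [ln _ *+ 2]mulr2n; lra.
Qed.

Lemma bin_le_2exp r k : ('C(r, k) <= 2 ^ r)%N.
Proof.
elim: r k => [|r IH] [|k] //; first by rewrite bin0 expn_gt0.
by rewrite binS expnS mul2n -addnn leq_add.
Qed.

End Sums.

(** * The largest remaining multiplicity *)

Section Deck.
Context {R : realType} {n : nat} (mm : 'I_n -> nat) (m : nat) (eps : R).
Hypothesis n_gt0 : (0 < n)%N.
Hypothesis eps_gt0 : 0 < eps.
Hypothesis mm_gt0 : forall i, (1 <= mm i)%N.
Hypothesis max_le : (max_mult mm <= m)%N.
Hypothesis frac_ge : eps <= max_frac R mm.

Local Notation N := (ncards mm).
Local Notation M := (max_mult mm).

Lemma mult_le i : (mm i <= m)%N.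
Proof. by rewrite (leq_trans _ max_le) // (leq_bigmax i). Qed.

Lemma ncards_ge : (n <= N)%N.
Proof.
by rewrite -[X in (X <= _)%N](card_ord n) -sum1_card leq_sum.
Qed.

Lemma ncards_le : (N <= m * n)%N.
Proof.
rewrite mulnC -[X in (_ <= X * _)%N](card_ord n) -sum_nat_const.
by apply: leq_sum => i _; exact: mult_le.
Qed.

Lemma ncards_gt0 : (0 < N)%N. Proof. exact: leq_trans n_gt0 ncards_ge. Qed.

Lemma max_gt0 : (0 < M)%N.
Proof. by rewrite (leq_trans (mm_gt0 (Ordinal n_gt0))) // (leq_bigmax (Ordinal n_gt0)). Qed.

Lemma m_gt0 : (0 < m)%N. Proof. exact: leq_trans max_gt0 max_le. Qed.

Lemma nR_gt0 : 0 < n%:R :> R. Proof. by rewrite ltr0n. Qed.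

Lemma bin_mult_le k l : 'C(mm l, k)%:R <= 2 ^+ m :> R.
Proof.
rewrite -natrX ler_nat (leq_trans (bin_le_2exp _ _)) // leq_exp2l //.
exact: mult_le.
Qed.

Lemma ksets0_le k : \sum_l 'C(mm l, k)%:R <= n%:R * 2 ^+ m :> R.
Proof.
apply: (@le_trans _ _ (\sum_(l < n) 2 ^+ m)).
  by apply: ler_sum => l _; exact: bin_mult_le.
by rewrite sumr_const card_ord mulr_natl.
Qed.

Lemma ksets0_ge k : (k <= M)%N -> eps * n%:R <= \sum_l 'C(mm l, k)%:R :> R.
Proof.
move=> kM; apply: (@le_trans _ _ #|[set i | mm i == M]%SET|%:R).
  by rewrite -ler_pdivlMr ?nR_gt0 // (le_trans frac_ge).
rewrite (bigID (mem [set i | mm i == M]%SET)) /= ler_wpDr ?sumr_ge0 //.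
rewrite -sum1_card natr_sum; apply: ler_sum => l; rewrite inE => /eqP ->.
by rewrite ler1n bin_gt0.
Qed.

(** The three summands serve the lower bound on the mean of ksets, the range
    t < k, and the upper bound on the mean of ksets. *)
Definition deck_const : R := 2 ^+ m * (m%:R ^+ 2) ^+ m / eps + m%:R ^+ m + 2 ^+ m.

Lemma deck_const_ge : [/\ 2 ^+ m * (m%:R ^+ 2) ^+ m / eps <= deck_const,
  m%:R ^+ m <= deck_const & 2 ^+ m <= deck_const].
Proof.
have h1 : 0 <= 2 ^+ m * (m%:R ^+ 2) ^+ m / eps.
  by rewrite divr_ge0 ?(ltW eps_gt0) // mulr_ge0 ?exprn_ge0.
have h2 : 0 <= m%:R ^+ m :> R by rewrite exprn_ge0.
have h3 : 0 <= 2 ^+ m :> R by rewrite exprn_ge0.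
by split; rewrite /deck_const; lra.
Qed.

Lemma deck_const_ge1 : 1 <= deck_const.
Proof.
have [_ _] := deck_const_ge; apply: le_trans.
by rewrite exprn_ege1 // ler1n.
Qed.

Definition top_prob k t : R := deal mm (N - t) (fun h => (k <= top mm h)%N%:R).

Lemma deal_mean t : is_mean (@deal R n mm (N - t)).
Proof. exact: deal_is_mean (leq_subr _ _). Qed.

Lemma top_prob01 k t : 0 <= top_prob k t <= 1.
Proof.
apply/andP; split; first exact: (mean_ge0 (deal_mean t)).
rewrite -[leRHS](mean1 (deal_mean t)); apply: (ler_mean (deal_mean t)) => h.
by case: (_ <= _)%N.
Qed.

(** First moment bound: the probability that some type has k cards left is at most
    the mean number of k-subsets of equal cards, which is of order
    n (t/n)^k. *)
Lemma top_prob_small k t : (0 < k)%N -> (t <= N)%N ->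
  top_prob k t <= deck_const * (n%:R * (t%:R / n%:R) ^+ k).
Proof.
move=> k0 tN; apply: (le_trans (top_prob_le (leq_subr _ _) k0)).
apply: (le_trans (@deal_ksets_le R n mm (N - t) k (leq_subr _ _) ncards_gt0)); rewrite subKn //.
have [_ _ h3] := deck_const_ge.
rewrite mulrA [_ * n%:R]mulrC; apply: ler_pM.
- exact: sumr_ge0.
- by rewrite exprn_ge0 // divr_ge0.
- by rewrite (le_trans (ksets0_le k)) // ler_wpM2l.
- rewrite lerXn2r ?nnegrE ?divr_ge0 // ler_wpM2l //.
  by rewrite lef_pV2 ?posrE ?ltr0n ?ncards_gt0 // ler_nat ncards_ge.
Qed.

(** Second moment bound. At least eps n types occur with the maximal multiplicity,
    so the mean number of k-subsets of equal cards is also at least of order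
    n (t/n)^k when t >= k; for t < k that quantity is bounded anyway. *)
Lemma top_prob_large k t : (0 < k <= M)%N -> (0 < t <= N)%N ->
  (1 - top_prob k t) * (n%:R * (t%:R / n%:R) ^+ k) <= deck_const.
Proof.
move=> /andP[k0 kM] /andP[t0 tN].
have [h1 h2 _] := deck_const_ge; have n0 := nR_gt0.
have /andP[p0 p1] := top_prob01 k t.
have r0 : 0 <= n%:R * (t%:R / n%:R) ^+ k :> R.
  by rewrite mulr_ge0 // exprn_ge0 // divr_ge0.
have km : (k <= m)%N := leq_trans kM max_le.
have m1 : 1 <= m%:R :> R by rewrite ler1n m_gt0.
have [kt|tk] := leqP k t; last first.
  apply: (le_trans _ h2); apply: (@le_trans _ _ (n%:R * (t%:R / n%:R) ^+ k)).
    by rewrite ler_piMl // gerBl.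
  apply: (@le_trans _ _ (t%:R ^+ k)).
    rewrite expr_div_n mulrCA ler_piMr ?exprn_ge0 //.
    rewrite ler_pdivrMr ?exprn_gt0 // mul1r -[leLHS]expr1.
    by rewrite ler_weXn2l // ler1n.
  apply: (@le_trans _ _ (m%:R ^+ k)).
    by rewrite lerXn2r ?nnegrE // ler_nat (leq_trans (ltnW tk)).
  by rewrite ler_weXn2l.
have e_ge : eps * (n%:R * (t%:R / n%:R) ^+ k) / (m%:R ^+ 2) ^+ m <= deal mm (N - t) (ksets mm k).
  rewrite deal_ksets ?leq_subr // mulrA -mulrA; apply: ler_pM.
  - by rewrite mulr_ge0 ?(ltW eps_gt0).
  - by rewrite divr_ge0 ?exprn_ge0 ?divr_ge0.
  - exact: ksets0_ge.
  - have jk : (N - t + k <= N)%N by rewrite -(subnK tN) addnK leq_add2l.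
    apply: le_trans (survival_ge jk); rewrite subKn //.
    apply: (@le_trans _ _ ((t%:R / n%:R / (m%:R ^+ 2)) ^+ k)).
      rewrite [leRHS]expr_div_n ler_wpM2l ?exprn_ge0 ?divr_ge0 //.
      rewrite lef_pV2 ?posrE ?exprn_gt0 ?ltr0n ?m_gt0 //.
      by rewrite ler_weXn2l // exprn_ege1.
    have kR : 1 <= k%:R :> R by rewrite ler1n.
    have ktR : k%:R <= t%:R :> R by rewrite ler_nat.
    have kmR : k%:R <= m%:R :> R by rewrite ler_nat.
    have tNR : t%:R <= N%:R :> R by rewrite ler_nat.
    have NmR : N%:R <= m%:R * n%:R :> R by rewrite -natrM ler_nat ncards_le.
    have D0 : 0 < N%:R - k%:R + 1 :> R by lra.
    rewrite lerXn2r ?nnegrE ?divr_ge0 //; first lra; first exact: ltW.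
    have nm : n%:R != 0 :> R by rewrite gt_eqF.
    have mn : m%:R != 0 :> R by rewrite gt_eqF //; lra.
    rewrite ler_pdivlMr //
      (_ : _ * _ = t%:R * (N%:R - k%:R + 1) / (n%:R * m%:R ^+ 2)); last by field; rewrite nm mn.
    have m0 : 0 < m%:R :> R by lra.
    rewrite ler_pdivrMr ?mulr_gt0 ?exprn_gt0 //.
    apply: (@le_trans _ _ (t%:R * N%:R)); first by rewrite ler_wpM2l //; lra.
    apply: (@le_trans _ _ (t%:R * (m%:R * n%:R))); first by rewrite ler_wpM2l.
    have : t%:R <= (t%:R - k%:R + 1) * m%:R :> R by nra.
    have : 0 <= m%:R * n%:R :> R by rewrite mulr_ge0.
    rewrite expr2; nra.
have e0 : 0 < deal mm (N - t) (@ksets R n mm k).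
  apply: lt_le_trans e_ge; rewrite divr_gt0 ?exprn_gt0 ?ltr0n ?m_gt0 //.
  by rewrite !mulr_gt0 // exprn_gt0 // divr_gt0 // ltr0n.
apply: (le_trans _ h1).
rewrite ler_pdivlMr // -mulrA [X in _ * X]mulrC.
rewrite -ler_pdivrMr ?exprn_gt0 ?ltr0n ?m_gt0 //.
apply: (@le_trans _ _ ((1 - top_prob k t) * deal mm (N - t) (ksets mm k))).
  by rewrite -mulrA ler_wpM2l // subr_ge0.
rewrite -ler_pdivlMr //; apply: top_prob_ge (leq_subr _ _) _ e0.
by move=> l; exact: bin_mult_le.
Qed.

(** The number n^(1 - 1/k) of remaining cards around which some type first has k
    cards left, when the deck is read from the bottom. *)
Definition threshold k : R := n%:R `^ (k.-1%:R / k%:R).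

Lemma thresholdX k : (0 < k)%N -> threshold k ^+ k = n%:R ^+ k.-1.
Proof.
move=> k0; rewrite -powR_mulrn ?powR_ge0 // -powRrM divfK ?pnatr_eq0 ?gtn_eqF //.
by rewrite powR_mulrn.
Qed.

Lemma threshold_ge1 k : 1 <= threshold k.
Proof. by rewrite -[leLHS](powRr0 n%:R) ler_powR ?ler1n // divr_ge0. Qed.

Lemma threshold_le k : threshold k <= n%:R.
Proof.
rewrite -[leRHS](powRr1 (ler0n _ n)) ler_powR ?ler1n //.
case: k => [|k]; first by rewrite mul0r.
by rewrite ler_pdivrMr ?ltr0n // mul1r ler_nat.
Qed.

Lemma ln_threshold k : (0 < k)%N -> ln n%:R - ln (threshold k) = ln n%:R / k%:R.
Proof.
move=> k0; rewrite ln_powR; case: k k0 => // k _ /=.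
by rewrite -natr1; field; rewrite natr1 pnatr_eq0.
Qed.

Lemma threshold_ratio k t : (0 < k)%N ->
  n%:R * (t%:R / n%:R) ^+ k = (t%:R / threshold k) ^+ k.
Proof.
move=> k0; have n0 := nR_gt0; rewrite !expr_div_n thresholdX //.
by case: k k0 => // k _ /=; rewrite [n%:R ^+ k.+1]exprS; field; rewrite expf_neq0 gt_eqF.
Qed.

Lemma threshold_sqrt k : (2 <= k)%N -> Num.sqrt n%:R <= threshold k.
Proof.
move=> k2; rewrite -powR12_sqrt // ler_powR ?ler1n //.
rewrite ler_pdivlMr ?ltr0n ?(ltn_trans _ k2) // mulrC ler_pdivrMr //.
by rewrite -natrM ler_nat; lia.
Qed.

Lemma top_prob_dev k t : (0 < k <= M)%N -> (0 < t <= N)%N ->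
  `|top_prob k t - (threshold k <= t%:R)%R%:R| <= deck_const * min_inv (t%:R / threshold k).
Proof.
move=> kM tN; have /andP[k0 _] := kM; have /andP[t0 tN'] := tN.
have T1 := threshold_ge1 k; have T0 : 0 < threshold k by lra.
have tR : 0 < t%:R :> R by rewrite ltr0n.
have K1 := deck_const_ge1.
have hs := top_prob_small k0 tN'; have hl := top_prob_large kM tN.
rewrite threshold_ratio // in hs; rewrite threshold_ratio // in hl.
have /andP[p0 p1] := top_prob01 k t.
set x := t%:R / threshold k in hs hl *.
have x0 : 0 < x by rewrite divr_gt0.
rewrite /min_inv minEle.
have [Tt|tT] := leP (threshold k) t%:R.
  have x1 : 1 <= x by rewrite ler_pdivlMr // mul1r.
  rewrite ler0_norm ?subr_le0 // opprB.
  have xk : x <= x ^+ k by rewrite -[leLHS]expr1 ler_weXn2l.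
  have bound : 1 - top_prob k t <= deck_const * x^-1.
    rewrite ler_pdivlMr //; apply: le_trans hl.
    by rewrite ler_wpM2l // subr_ge0.
  case: ifP => // _; apply: (le_trans bound); rewrite ler_wpM2l //; first by lra.
  by rewrite (le_trans _ x1) // invf_le1.
have x1 : x <= 1 by rewrite ler_pdivrMr // mul1r ltW.
rewrite subr0 ger0_norm //.
have xk : x ^+ k <= x by rewrite -[leRHS]expr1 ler_wiXn2l // ltW.
have -> : x <= x^-1 by rewrite (le_trans x1) // invf_ge1.
by apply: (le_trans hs); rewrite ler_wpM2l //; lra.
Qed.

(** The variance q (1 - q) of an indicator is at most each of q and 1 - q, of which
    the first is small below the threshold and the second above it. For k >= 2
    the power k is at least the square that the variance needs. *)
Lemma top_prob_sdev k t : (2 <= k <= M)%N -> (0 < t <= N)%N ->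
  sdev (@deal R n mm (N - t)) (fun h => (k <= top mm h)%N%:R) <=
  Num.sqrt deck_const * min_inv (t%:R / threshold k).
Proof.
move=> /andP[k2 kM] tN; have k0 : (0 < k)%N by rewrite (ltn_trans _ k2).
have /andP[t0 tN'] := tN.
have T1 := threshold_ge1 k; have T0 : 0 < threshold k by lra.
have tR : 0 < t%:R :> R by rewrite ltr0n.
have K1 := deck_const_ge1.
have hs := top_prob_small k0 tN'; have hl : _ := @top_prob_large k t (introT andP (conj k0 kM)) tN.
rewrite threshold_ratio // in hs; rewrite threshold_ratio // in hl.
have /andP[p0 p1] := top_prob01 k t.
set x := t%:R / threshold k in hs hl *.
have x0 : 0 < x by rewrite divr_gt0.
have c0 : 0 <= min_inv x by rewrite min_inv_ge0 // ltW.
rewrite -[leLHS]ger0_norm ?sdev_ge0 // -[leRHS]ger0_norm ?mulr_ge0 //.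
rewrite -!sqrtr_sqr ler_wsqrtr // exprMn (@sqr_sqrtr _ deck_const) ?(le_trans ler01) //.
rewrite (sqr_sdev_indic (deal_mean t)) -/(top_prob k t) /min_inv minEle.
have [xl|xl] := leP x 1.
  have -> : x <= x^-1 by rewrite (le_trans xl) // invf_ge1.
  have xk : x ^+ k <= x ^+ 2 by rewrite ler_wiXn2l // ltW.
  apply: (@le_trans _ _ (top_prob k t)); first by rewrite ler_piMr // gerBl.
  by apply: (le_trans hs); rewrite ler_wpM2l //; lra.
have -> : (x <= x^-1) = false.
  by apply/negbTE; rewrite -ltNge (le_lt_trans _ xl) // invf_le1 ?ltW.
have xk : x ^+ 2 <= x ^+ k by rewrite ler_weXn2l // ltW.
apply: (@le_trans _ _ (1 - top_prob k t)); first by rewrite ler_piMl // subr_ge0.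
rewrite exprVn ler_pdivlMr ?exprn_gt0 //; apply: le_trans hl.
by rewrite ler_wpM2l // subr_ge0.
Qed.

Lemma top_le h : (top mm h <= M)%N.
Proof.
apply/bigmax_leqP => i _; apply: leq_trans (leq_subr _ _) _.
exact: (leq_bigmax i).
Qed.

Lemma top_sum h : ((top mm h)%:R = \sum_(k < M) (k.+1 <= top mm h)%N%:R :> R).
Proof.
rewrite -natr_sum; congr (_%:R).
suff H b T : (\sum_(k < b) (k < T) = minn b T)%N by rewrite H (minn_idPr (top_le h)).
by elim: b => [|b IH]; rewrite ?big_ord0 ?min0n // big_ord_recr /= IH; lia.
Qed.

Lemma top_gt0 h : valid mm h -> (size h < N)%N -> (0 < top mm h)%N.
Proof.
move=> vh hN; have := sum_remaining vh; rewrite lt0n => s.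
apply/eqP => t0; move: hN; rewrite -subn_gt0 -s lt0n sum_nat_eq0 negb_forall.
move=> /existsP[i]; rewrite /= -lt0n ltnNge => /negP; apply.
by rewrite -t0 (leq_bigmax i).
Qed.

(** The standard deviation of the conditional success probability of the greedy
    guess with t cards left. *)
Definition spread t : R := sdev (@deal R n mm (N - t)) (fun h => (top mm h)%:R) / t%:R.

Lemma spread_ge0 t : 0 <= spread t.
Proof. by rewrite divr_ge0 // sdev_ge0. Qed.

(** The greatest remaining multiplicity is the sum over k of the indicators that it
    is at least k. The indicator for k = 1 is constant while cards remain, so only the
    thresholds with k >= 2 contribute. *)
Lemma spread_le t : (0 < t <= N)%N -> spread t <=
  Num.sqrt deck_const * \sum_(1 <= k < M) min_inv (t%:R / threshold k.+1) / t%:R.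
Proof.
move=> tN; have /andP[t0 tN'] := tN.
rewrite -mulr_suml mulrA ler_wpM2r ?invr_ge0 //.
rewrite (@eq_sdev _ _ _ _ _ top_sum).
apply: (le_trans (sdev_sum (deal_mean t) _ _)).
rewrite -(big_mkord xpredT (fun k => sdev (deal mm (N - t)) (fun h => (k < top mm h)%N%:R))).
rewrite big_ltn ?max_gt0 //= [X in X + _](_ : _ = 0) ?add0r.
  rewrite mulr_sumr ler_sum_nat // => k /andP[k1 kM].
  by rewrite top_prob_sdev // kM andbT ltnS.
rewrite -(sdev_cst (deal_mean t) 1) /sdev.
suff e (F : R -> R) : deal mm (N - t) (fun h => F ((0 < top mm h)%N%:R)) =
    deal mm (N - t) (fun=> F 1).
  by rewrite (e id) (e (fun x => (x - _) ^+ 2)).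
apply: eq_deal => h hj vh; rewrite top_gt0 //.
by rewrite hj -subn_gt0 subKn.
Qed.

(** The decisive estimate: the random success probabilities deviate from their
    means by a bounded total amount, uniformly in n. *)
Lemma sum_spread_le : \sum_(t < N) spread t.+1 <= 4 * m%:R * Num.sqrt deck_const.
Proof.
apply: (@le_trans _ _ (\sum_(t < N) Num.sqrt deck_const *
    \sum_(1 <= k < M) min_inv (t.+1%:R / threshold k.+1) / t.+1%:R)).
  by apply: ler_sum => t _; rewrite spread_le //= ltn_ord.
rewrite -mulr_sumr mulrC ler_wpM2r // exchange_big /=.
apply: (@le_trans _ _ (\sum_(1 <= k < M) 4)).
  by apply: ler_sum => k _; rewrite sum_min_inv_le // threshold_ge1.
rewrite sumr_const_nat -[4 *+ _]mulr_natr ler_wpM2l // ler_nat.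
by rewrite (leq_trans (leq_subr _ _)).
Qed.

Lemma spread_le_sqrt t : (0 < t <= N)%N ->
  spread t <= m%:R * Num.sqrt deck_const / Num.sqrt n%:R.
Proof.
move=> tN; apply: (le_trans (spread_le tN)); have /andP[t0 _] := tN.
rewrite mulrAC [leRHS]mulrC ler_wpM2l //.
apply: (@le_trans _ _ (\sum_(1 <= k < M) (Num.sqrt n%:R)^-1)).
  rewrite ler_sum_nat // => k /andP[k1 kM].
  have T1 := threshold_ge1 k.+1; have T0 : 0 < threshold k.+1 by lra.
  apply: (@le_trans _ _ (threshold k.+1)^-1).
    by rewrite ler_pdivrMr ?ltr0n // [leRHS]mulrC /min_inv ge_min lexx.
  by rewrite lef_pV2 ?posrE ?sqrtr_gt0 ?nR_gt0 // threshold_sqrt.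
rewrite sumr_const_nat -[_^-1 *+ _]mulr_natl ler_wpM2r ?invr_ge0 // ler_nat.
by rewrite (leq_trans (leq_subr _ _)).
Qed.

Definition harmonic_number M' : R := \sum_(1 <= k < M'.+1) k%:R^-1.

(** The mean of the greatest remaining multiplicity is close to the number of k with
    threshold at most t, and the reciprocals of the t above the threshold
    n^(1 - 1/k) sum to (ln n)/k up to a constant. *)
Lemma mean_top_sum :
  `|\sum_(t < N) deal mm (N - t.+1) (fun h => (top mm h)%:R) / t.+1%:R
    - harmonic_number M * ln n%:R| <= m%:R * (4 * deck_const + 2 + ln m%:R).
Proof.
have -> : \sum_(t < N) deal mm (N - t.+1) (fun h => (top mm h)%:R) / t.+1%:R
    - harmonic_number M * ln n%:R =
  \sum_(k < M) (\sum_(t < N) top_prob k.+1 t.+1 / t.+1%:R - ln n%:R / k.+1%:R).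
  rewrite sumrB exchange_big /=; congr (_ - _).
    apply: eq_bigr => t _; rewrite -mulr_suml; congr (_ / _).
    by rewrite -(mean_sum (deal_mean _)); apply: eq_mean => h; exact: top_sum.
  rewrite /harmonic_number big_add1 /= big_mkord mulr_suml.
  by apply: eq_bigr => k _; rewrite mulrC.
apply: (le_trans (ler_norm_sum _ _ _)).
have K1 := deck_const_ge1.
have lnm : 0 <= ln m%:R :> R by rewrite ln_ge0 // ler1n m_gt0.
apply: (@le_trans _ _ (\sum_(k < M) (4 * deck_const + 2 + ln m%:R))); last first.
  by rewrite sumr_const card_ord -[(_ + _) *+ _]mulr_natl ler_wpM2r ?ler_nat //; lra.
apply: ler_sum => k _.
have T1 := threshold_ge1 k.+1; have Tn := threshold_le k.+1.
have TN : threshold k.+1 <= N%:R by rewrite (le_trans Tn) // ler_nat ncards_ge.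
have tail := harmonic_tail T1 TN.
have dev : `|\sum_(t < N) top_prob k.+1 t.+1 / t.+1%:R -
    \sum_(t < N) (threshold k.+1 <= t.+1%:R)%R%:R / t.+1%:R| <= 4 * deck_const.
  rewrite -sumrB; apply: (le_trans (ler_norm_sum _ _ _)).
  apply: (@le_trans _ _ (deck_const * \sum_(t < N) min_inv (t.+1%:R / threshold k.+1) / t.+1%:R)).
    rewrite mulr_sumr; apply: ler_sum => t _.
    rewrite -mulrBl normrM (@ger0_norm _ _^-1) ?invr_ge0 // mulrA ler_wpM2r ?invr_ge0 //.
    by rewrite top_prob_dev //= ltn_ord.
  by rewrite mulrC ler_wpM2r ?sum_min_inv_le //; lra.
have lnT := ln_threshold (ltn0Sn k).
have lnN1 : ln n%:R <= ln N%:R :> R.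
  by rewrite ler_ln ?posrE ?ltr0n ?ncards_gt0 // ler_nat ncards_ge.
have lnN2 : ln N%:R <= ln m%:R + ln n%:R :> R.
  rewrite -lnM ?posrE ?ltr0n ?m_gt0 // ler_ln ?posrE ?mulr_gt0 ?ltr0n ?ncards_gt0 ?m_gt0 //.
  by rewrite -natrM ler_nat ncards_le.
move: tail dev; rewrite -lnT; set X := \sum_(t < N) top_prob _ _ / _; set Y := \sum_(t < N) _ / _.
rewrite !ler_norml => /andP[? ?] /andP[? ?]; apply/andP; split; lra.
Qed.

End Deck.

(** * Comparing the score with a Poisson binomial law *)

Section Game.
Context {R : realType} {n : nat} (mm : 'I_n -> nat) (g : strategy n).
Hypothesis g_greedy : greedy mm g.
Local Notation N := (ncards mm).
Local Notation deal := (@deal R n mm).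
Local Notation top := (top mm).

Lemma greedy_top h : valid mm h -> (size h < N)%N ->
  exists2 i, g h = Some i & remaining mm h i = top h.
Proof.
move=> /forallP vh hN; have [i [gi imax]] := g_greedy vh hN.
exists i => //; apply/eqP; rewrite eqn_leq (leq_bigmax i) /=.
exact/bigmax_leqP.
Qed.

(** The greedy guess has maximal multiplicity, so its success probability is
    determined by the remaining multiplicities, however ties are broken. *)
Lemma deal_hits_step j (H : nat -> R) : (j < N)%N ->
  deal j.+1 (fun h => H (hits g h)) =
  deal j (fun h => (top h)%:R / (N - j)%:R * H (hits g h).+1 +
                   (1 - (top h)%:R / (N - j)%:R) * H (hits g h)).
Proof.
move=> jN; rewrite deal_step //; apply: eq_deal => h hj vh.
have [|i gi itop] := greedy_top vh; first by rewrite hj.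
have s1 := @sum_weights1 R n mm j h jN hj vh.
rewrite (bigD1 i) //= hits_rcons gi eqxx addn1 itop; congr (_ + _).
have <- : \sum_(k | k != i) (remaining mm h k)%:R / (N - j)%:R =
    1 - (top h)%:R / (N - j)%:R :> R.
  by rewrite -[X in _ = X - _]s1 [X in _ = X - _](bigD1 i) //= itop addrAC subrr add0r.
rewrite mulr_suml.
apply: eq_bigr => k ki; rewrite hits_rcons gi.
have -> : (Some i == Some k) = false by apply/negbTE; rewrite eq_sym.
by rewrite addn0.
Qed.

(** The mean success probability of the guess made with t cards left. *)
Definition success_prob t : R := deal (N - t) (fun h => (top h)%:R) / t%:R.

Fixpoint success_probs t : seq R :=
  if t is t'.+1 then success_prob t :: success_probs t' else [::].

Lemma top_le_left h t : valid mm h -> (t <= N)%N -> size h = (N - t)%N -> (top h <= t)%N.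
Proof.
move=> vh tN hN; have := sum_remaining vh; rewrite hN subKn // => <-.
by apply/bigmax_leqP => i _; rewrite (bigD1 i) //= leq_addr.
Qed.

Lemma success_prob01 t : (t <= N)%N -> 0 <= success_prob t <= 1.
Proof.
move=> tN; have mE := @deal_is_mean R n mm _ (leq_subr t N).
case: t tN mE => [|t] tN mE; first by rewrite /success_prob invr0 mulr0 lexx ler01.
rewrite divr_ge0 ?(mean_ge0 mE) // ler_pdivrMr ?ltr0n // mul1r.
rewrite -[leRHS](mean_cst mE).
have -> : deal (N - t.+1) (fun h => (top h)%:R) =
    deal (N - t.+1) (fun h => Num.min (top h)%:R t.+1%:R).
  apply: eq_deal => h hN vh; rewrite min_l // ler_nat.
  exact: top_le_left vh tN hN.
by apply: (ler_mean mE) => h; rewrite ge_min lexx orbT.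
Qed.

Lemma probs_success_probs t : (t <= N)%N -> probs (success_probs t).
Proof.
elim: t => //= t IH tN; rewrite IH ?(ltnW tN) // andbT.
exact: success_prob01.
Qed.

Lemma success_probs_mean t : pbinom_mean (success_probs t) = \sum_(s < t) success_prob s.+1.
Proof.
elim: t => [|t IH]; first by rewrite /pbinom_mean big_nil big_ord0.
by rewrite /pbinom_mean /= big_cons -/(pbinom_mean _) IH big_ord_recr addrC.
Qed.

Lemma success_probs_var t :
  pbinom_var (success_probs t) = \sum_(s < t) success_prob s.+1 * (1 - success_prob s.+1).
Proof.
elim: t => [|t IH]; first by rewrite /pbinom_var big_nil big_ord0.
by rewrite /pbinom_var /= big_cons -/(pbinom_var _) IH big_ord_recr addrC.
Qed.

Definition hits_mean t : R := deal (N - t) (fun h => (hits g h)%:R).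

Lemma subnSS_lt t : (t < N)%N -> [/\ (N - t.+1 < N)%N, (N - t)%N = (N - t.+1).+1
  & (N - (N - t.+1))%N = t.+1].
Proof. by move=> tN; split; lia. Qed.

Lemma hits_mean_step t : (t < N)%N -> hits_mean t = hits_mean t.+1 + success_prob t.+1.
Proof.
move=> tN; have [h1 h2 h3] := subnSS_lt tN.
have mE := @deal_is_mean R n mm _ (ltnW h1).
rewrite /hits_mean h2 deal_hits_step // h3 /success_prob [X in _ + X]mulrC -(meanZ mE) -(meanD mE).
by apply: eq_mean => h; rewrite -natr1; ring.
Qed.

Lemma hits_meanN : hits_mean N = 0.
Proof. by rewrite /hits_mean subnn /= /hits big_ord0. Qed.

Lemma sum_telescope (f : nat -> R) : \sum_(t < N) (f t - f t.+1) = f 0%N - f N.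
Proof.
rewrite -[RHS]opprB -(telescope_sumr f (leq0n N)) big_mkord -sumrN.
by apply: eq_bigr => t _; rewrite opprB.
Qed.

Lemma hits_mean_pbinom : hits_mean 0 = pbinom_mean (success_probs N).
Proof.
rewrite success_probs_mean; have := sum_telescope hits_mean; rewrite hits_meanN subr0 => <-.
by apply: eq_bigr => t _; rewrite hits_mean_step // addrAC subrr add0r.
Qed.

Lemma deal_dev_le t (D : seq 'I_n -> R) (d : R) : (t < N)%N ->
  Num.sqrt (deal (N - t.+1) (fun h => D h ^+ 2)) <= d ->
  `|deal (N - t.+1) (fun h => ((top h)%:R / t.+1%:R - success_prob t.+1) * D h)| <=
  @spread R n mm t.+1 * d.
Proof.
move=> tN dP; have [h1 h2 h3] := subnSS_lt tN.
have mE := @deal_is_mean R n mm _ (ltnW h1).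
set j := (N - t.+1)%N in dP mE *.
rewrite (@eq_mean _ _ (deal j) _ (fun h => t.+1%:R^-1 *
   (((top h)%:R - deal j (fun h => (top h)%:R)) * D h))); last first.
  by move=> h; rewrite /success_prob -/j; ring.
rewrite (meanZ mE) normrM ger0_norm ?invr_ge0 // mulrC /spread -/j mulrAC.
rewrite ler_wpM2r ?invr_ge0 //.
apply: (le_trans (mean_CauchySchwarz mE _ _)).
by rewrite ler_wpM2l // sqrtr_ge0.
Qed.

(** Lindeberg's replacement. The hybrid U_t plays the game until t cards are left and
    then replaces the remaining guesses by independent Bernoulli variables with
    the mean success probabilities. Two consecutive hybrids differ by the mean of
    the deviation of one success probability times one increment of the
    Bernoulli mean of H. *)
Lemma hits_vs_pbinom (H : nat -> R) (d : nat -> R) :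
  (forall t s, (t < N)%N ->
    `|pbinom (success_probs t) (fun w => H (s.+1 + w)%N) -
      pbinom (success_probs t) (fun w => H (s + w)%N)| <= d t) ->
  `|deal N (fun h => H (hits g h)) - pbinom (success_probs N) H| <=
  \sum_(t < N) @spread R n mm t.+1 * d t.
Proof.
move=> dP.
pose u t s : R := pbinom (success_probs t) (fun w => H (s + w)%N).
pose U t : R := deal (N - t) (fun h => u t (hits g h)).
have -> : deal N (fun h => H (hits g h)) = U 0%N.
  by rewrite /U subn0 /u /=; apply: eq_mean => h; rewrite addn0.
have -> : pbinom (success_probs N) H = U N by rewrite /U subnn /u /= /hits big_ord0.
rewrite -sum_telescope; apply: (le_trans (ler_norm_sum _ _ _)).
apply: ler_sum => t _; have tN := ltn_ord t.
have [h1 h2 h3] := subnSS_lt tN.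
have mE := @deal_is_mean R n mm _ (ltnW h1).
have d0 : 0 <= d t by apply: le_trans (dP t 0%N tN).
have -> : U t - U t.+1 = deal (N - t.+1) (fun h =>
   ((top h)%:R / t.+1%:R - success_prob t.+1) * (u t (hits g h).+1 - u t (hits g h))).
  rewrite /U h2 (deal_hits_step (u t)) // h3 -(meanB mE); apply: eq_mean => h.
  rewrite {3}/u /= -/(u t (hits g h)).
  have -> : pbinom (success_probs t) ((fun w => H (hits g h + w)%N) \o S) = u t (hits g h).+1.
    by apply: eq_mean => w /=; rewrite addnS addSn.
  ring.
apply: deal_dev_le => //.
rewrite -[leRHS]ger0_norm // -[leRHS]sqrtr_sqr ler_wsqrtr //.
rewrite -[leRHS](mean_cst mE); apply: (ler_mean mE) => h.
rewrite -(real_normK (num_real (u _ _ - _))) lerXn2r ?nnegrE //.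
exact: dP.
Qed.

Definition hits_var t : R := deal (N - t) (fun h => ((hits g h)%:R - hits_mean t) ^+ 2).

Lemma hits_var_ge0 t : 0 <= hits_var t.
Proof.
have mE := @deal_is_mean R n mm _ (leq_subr t N).
by apply: (mean_ge0 mE) => h; exact: sqr_ge0.
Qed.

(** The success with t + 1 cards left adds the variance of a Bernoulli variable with
    the mean success probability and twice the covariance of the earlier score
    with the conditional success probability. *)
Lemma hits_var_step t : (t < N)%N ->
  `|hits_var t - hits_var t.+1 - success_prob t.+1 * (1 - success_prob t.+1)| <=
  2 * (@spread R n mm t.+1 * Num.sqrt (hits_var t.+1)).
Proof.
move=> tN; have [h1 h2 h3] := subnSS_lt tN.
have mE := @deal_is_mean R n mm _ (ltnW h1).
have step := hits_mean_step tN.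
set j := (N - t.+1)%N in h1 h2 h3 mE *.
have dev := @deal_dev_le t (fun h => (hits g h)%:R - hits_mean t.+1) _ tN (lexx _).
rewrite -/j -/(hits_var t.+1) in dev.
suff -> : hits_var t - hits_var t.+1 - success_prob t.+1 * (1 - success_prob t.+1) =
  2 * deal j (fun h =>
    ((top h)%:R / t.+1%:R - success_prob t.+1) * ((hits g h)%:R - hits_mean t.+1)).
  by rewrite normrM ger0_norm // ler_wpM2l.
have center : deal j (fun h => (top h)%:R / t.+1%:R - success_prob t.+1) = 0.
  rewrite (meanB mE) (mean_cst mE) /success_prob -/j mulrC -(meanZ mE).
  by apply/eqP; rewrite subr_eq0; apply/eqP; apply: eq_mean => h; rewrite mulrC.
rewrite /hits_var h2 -/j (deal_hits_step (fun s => (s%:R - hits_mean t) ^+ 2)) // h3 step.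
rewrite -(mean_cst mE (success_prob t.+1 * (1 - success_prob t.+1))) -!(meanB mE) -(meanZ mE).
apply/eqP; rewrite -subr_eq0 -(meanB mE).
rewrite -[X in _ == X](mulr0 (1 - 2 * success_prob t.+1)) -center -(meanZ mE); apply/eqP.
by apply: eq_mean => h; rewrite -natr1; ring.
Qed.

Definition total_spread : R := \sum_(t < N) @spread R n mm t.+1.

Lemma hits_varN : hits_var N = 0.
Proof. by rewrite /hits_var hits_meanN subnn /= /hits big_ord0 subr0 expr0n. Qed.

(** By hits_var_step the standard deviation v of the score obeys the recursion
    v'^2 <= (v + a)^2 + pq, where a is the spread of the next step; the triangle
    inequality for the pair (sum of the a, root of the sum of the pq) bounds
    its solution. *)
Lemma sqrt_hits_var_le t : (t <= N)%N ->
  Num.sqrt (hits_var t) <= Num.sqrt (pbinom_var (success_probs N)) + total_spread.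
Proof.
pose W t : R := \sum_(t <= s < N) success_prob s.+1 * (1 - success_prob s.+1).
pose A t : R := \sum_(t <= s < N) @spread R n mm s.+1.
have W0 s : 0 <= W s.
  rewrite /W big_nat_cond sumr_ge0 // => k /andP[/andP[_ kN] _].
  by have /andP[p0 p1] := success_prob01 kN; rewrite mulr_ge0 // subr_ge0.
have A0 s : 0 <= A s by apply: sumr_ge0 => k _; exact: spread_ge0.
have key j : (j <= N)%N -> Num.sqrt (hits_var (N - j)) <= Num.sqrt (W (N - j)%N) + A (N - j)%N.
  elim: j => [|j IH] jN.
    by rewrite subn0 hits_varN sqrtr0 addr_ge0 ?sqrtr_ge0.
  have {}IH := IH (ltnW jN).
  have e : (N - j)%N = (N - j.+1).+1 by lia.
  rewrite e in IH; set s := (N - j.+1)%N in IH e *.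
  have sN : (s < N)%N by rewrite /s; lia.
  have := hits_var_step sN; rewrite ler_norml => /andP[_ step].
  have Ws : W s = success_prob s.+1 * (1 - success_prob s.+1) + W s.+1 by rewrite /W big_ltn.
  have As : A s = @spread R n mm s.+1 + A s.+1 by rewrite /A big_ltn.
  have a0 : 0 <= @spread R n mm s.+1 := spread_ge0 _ _.
  have pq0 : 0 <= success_prob s.+1 * (1 - success_prob s.+1).
    by have /andP[p0 p1] := success_prob01 sN; rewrite mulr_ge0 // subr_ge0.
  set x := Num.sqrt (hits_var s.+1) in IH step.
  have x0 : 0 <= x by exact: sqrtr_ge0.
  have xx : hits_var s.+1 = x ^+ 2 by rewrite sqr_sqrtr ?hits_var_ge0.
  set y := Num.sqrt (W s.+1) in IH *.
  have y0 : 0 <= y by exact: sqrtr_ge0.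
  have yy : W s.+1 = y ^+ 2 by rewrite sqr_sqrtr.
  set z := Num.sqrt (W s).
  have z0 : 0 <= z by exact: sqrtr_ge0.
  have zz : W s = z ^+ 2 by rewrite sqr_sqrtr.
  have yz : y <= z by rewrite ler_wsqrtr // Ws lerDr.
  rewrite -[leRHS]ger0_norm ?addr_ge0 // -sqrtr_sqr ler_wsqrtr //.
  have A1 := A0 s.+1; rewrite As.
  set a := spread _ _ in step a0 As *; set b := A s.+1 in IH A1 As *.
  have : (x + a) ^+ 2 <= (y + b + a) ^+ 2 by rewrite lerXn2r ?nnegrE ?addr_ge0 // lerD2r.
  have : (y + (a + b)) * (a + b) <= (z + (a + b)) * (a + b) by rewrite ler_wpM2r ?addr_ge0 ?lerD2r.
  have : y * (a + b) <= z * (a + b) by rewrite ler_wpM2r ?addr_ge0.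
  have : 0 <= a ^+ 2 by exact: sqr_ge0.
  move: step; rewrite xx => step.
  have : z ^+ 2 = success_prob s.+1 * (1 - success_prob s.+1) + y ^+ 2 by rewrite -zz -yy.
  nra.
move=> tN; have := key (N - t)%N (leq_subr _ _); rewrite subKn // => /le_trans; apply.
have full (f : nat -> R) : (forall s, (s < N)%N -> 0 <= f s) ->
    \sum_(t <= s < N) f s <= \sum_(s < N) f s.
  move=> f0; rewrite -(big_mkord xpredT f) [leRHS](big_cat_nat (n := t)) // /= ler_wpDl //.
  by rewrite big_nat_cond sumr_ge0 // => k /andP[/andP[_ kt] _]; rewrite f0 // (leq_trans kt).
apply: lerD.
  rewrite ler_wsqrtr // success_probs_var full // => s sN.
  by have /andP[p0 p1] := success_prob01 sN; rewrite mulr_ge0 // subr_ge0.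
by rewrite full // => s _; exact: spread_ge0.
Qed.

Lemma hits_var_pbinom : `|hits_var 0 - pbinom_var (success_probs N)| <=
  2 * total_spread * (Num.sqrt (pbinom_var (success_probs N)) + total_spread).
Proof.
have -> : hits_var 0 - pbinom_var (success_probs N) =
    \sum_(t < N) (hits_var t - hits_var t.+1 - success_prob t.+1 * (1 - success_prob t.+1)).
  by rewrite sumrB sum_telescope hits_varN subr0 success_probs_var.
apply: (le_trans (ler_norm_sum _ _ _)).
rewrite /total_spread -mulrA mulr_suml mulr_sumr; apply: ler_sum => t _.
apply: (le_trans (hits_var_step (ltn_ord t))); rewrite ler_wpM2l //.
by rewrite ler_wpM2l ?spread_ge0 // sqrt_hits_var_le.
Qed.

End Game.

(** * Bounds for a given deck *)

Section GameDeck.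
Context {R : realType} {n : nat} (mm : 'I_n -> nat) (g : strategy n) (m : nat) (eps : R).
Hypothesis n_gt0 : (0 < n)%N.
Hypothesis eps_gt0 : 0 < eps.
Hypothesis mm_gt0 : forall i, (1 <= mm i)%N.
Hypothesis max_le : (max_mult mm <= m)%N.
Hypothesis frac_ge : eps <= max_frac R mm.
Hypothesis g_greedy : greedy mm g.

Local Notation N := (ncards mm).
Local Notation M := (max_mult mm).
Local Notation ps := (@success_probs R n mm).
Local Notation p_ := (@success_prob R n mm).
Local Notation K := (deck_const m eps).
Local Notation L := (ln n%:R : R).

Lemma success_prob_bounds t : (t < N)%N -> t.+1%:R^-1 <= p_ t.+1 <= m%:R / t.+1%:R.
Proof.
move=> tN; have mE := @deal_is_mean R n mm _ (leq_subr t.+1 N).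
rewrite /success_prob -[X in X <= _ <= _]mul1r !ler_pM2r ?invr_gt0 ?ltr0n //; apply/andP; split.
  rewrite -[leLHS](mean_cst mE).
  have -> : deal mm (N - t.+1) (fun h => (top mm h)%:R) =
      deal mm (N - t.+1) (fun h => Num.max 1 (top mm h)%:R) :> R.
    apply: eq_deal => h hN vh; rewrite max_r // ler1n top_gt0 // hN.
    by rewrite -subn_gt0 subKn.
  by apply: (ler_mean mE) => h; rewrite le_max lexx.
rewrite -[leRHS](mean_cst mE); apply: (ler_mean mE) => h; rewrite ler_nat.
exact: leq_trans (top_le mm h) max_le.
Qed.

(** The gap is the sum of the squares of the success probabilities, each at most
    m/t. *)
Lemma pbinom_mean_var_gap t : (t <= N)%N ->
  0 <= pbinom_mean (ps t) - pbinom_var (ps t) <= 2 * m%:R ^+ 2.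
Proof.
move=> tN; rewrite success_probs_mean success_probs_var -sumrB.
have e (s : 'I_t) : p_ s.+1 - p_ s.+1 * (1 - p_ s.+1) = p_ s.+1 ^+ 2 by ring.
rewrite (eq_bigr _ (fun s _ => e s)) sumr_ge0 => [|s _]; last exact: sqr_ge0.
rewrite /= mulrC; apply: (@le_trans _ _ (m%:R ^+ 2 * \sum_(s < t) (s.+1%:R ^+ 2)^-1)).
  rewrite mulr_sumr; apply: ler_sum => s _.
  have /andP[p0 p1] := success_prob_bounds (leq_trans (ltn_ord s) tN).
  have p2 : 0 <= p_ s.+1 by apply: le_trans p0; rewrite invr_ge0.
  by rewrite -expr_div_n lerXn2r ?nnegrE ?p2 ?p1 // divr_ge0.
by rewrite ler_wpM2l ?sqr_ge0 // sum_inv_sqr_le.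
Qed.

Lemma success_probs_var_ge t : (t <= N)%N -> ln t%:R - 2 - 2 * m%:R ^+ 2 <= pbinom_var (ps t).
Proof.
move=> tN; have /andP[_ gap] := pbinom_mean_var_gap tN.
have : \sum_(s < t) s.+1%:R^-1 <= pbinom_mean (ps t).
  rewrite success_probs_mean; apply: ler_sum => s _.
  by have /andP[] := success_prob_bounds (leq_trans (ltn_ord s) tN).
have := @harmonic_ge R t; lra.
Qed.

Lemma threshold_jump (y : R) : exists a : nat, forall w : nat,
  `|(w.+1%:R <= y)%R%:R - (w%:R <= y)%R%:R| <= (w == a)%:R :> R.
Proof.
have step (w : nat) : w.+1%:R <= y -> w%:R <= y.
  by move=> h; apply: le_trans h; rewrite ler_nat.
have [[a /andP[a1 a2]]|no] := pselect (exists a : nat, (a%:R <= y) && (y < a.+1%:R)).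
  exists a => w; have [wa|wa] := eqVneq w a.
    by case: (_ <= y); case: (_ <= y);
       rewrite /= ?subrr ?subr0 ?sub0r ?normrN ?normr1 ?normr0 ?lexx ?ler01.
  case: (ltngtP w a) wa => // wa _.
    have h : w.+1%:R <= y by apply: le_trans a1; rewrite ler_nat.
    by rewrite h (step _ h) subrr normr0.
  have h : y < w%:R by apply: lt_le_trans a2 _; rewrite ler_nat.
  have h' : y < w.+1%:R by apply: lt_le_trans h _; rewrite ler_nat.
  by rewrite [w.+1%:R <= y]leNgt [w%:R <= y]leNgt h h' subrr normr0.
exists 0%N => w; apply: (@le_trans _ _ 0) => //; rewrite normr_le0 subr_eq0.
have [h1|h1] := leP w%:R y; have [h2|h2] := leP w.+1%:R y => //.
  by case: no; exists w; rewrite h1.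
by have := lt_le_trans h1 (step _ h2); rewrite ltxx.
Qed.

(** Shifting the sum by one changes the indicator of a half-line at a single
    point. *)
Lemma pbinom_jump (ps : seq R) (y d : R) (s : nat) : probs ps ->
  (forall a, pbinom ps (fun w => (w == a)%:R) <= d) ->
  `|pbinom ps (fun w => ((s.+1 + w)%:R <= y)%R%:R) -
    pbinom ps (fun w => ((s + w)%:R <= y)%R%:R)| <= d.
Proof.
move=> pps dP; have mE := pbinom_is_mean pps; have [a aP] := threshold_jump y.
have bound w : `|((s.+1 + w)%:R <= y)%R%:R - ((s + w)%:R <= y)%R%:R| <= (w == a - s)%N%:R :> R.
  apply: (le_trans (aP _)); rewrite ler_nat.
  by have [<-|] := eqVneq (s + w)%N a; rewrite // addKn eqxx.
rewrite -(meanB mE); apply: le_trans (dP (a - s)%N); rewrite ler_norml.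
rewrite -(meanN mE); apply/andP; split; apply: (ler_mean mE) => w;
  by have := bound w; rewrite ler_norml => /andP[].
Qed.

Definition coupling_const : R := 20 * m%:R * Num.sqrt K.

(** Steps with (t + 1)^8 > n are replaced while the Bernoulli variables to come still
    have variance of order ln n, so the increment is O(1 / sqrt(ln n)). For the
    other steps the trivial bound 1 on the increment suffices, because the spread
    is O(1 / sqrt n), hence O((t + 1)^(-2) / sqrt(ln n)). *)
Lemma score_cdf_vs_pbinom (y : R) : 16 * (3 + 2 * m%:R ^+ 2) <= L ->
  `|deal mm N (fun h => ((hits g h)%:R <= y)%R%:R) - pbinom (ps N) (fun w => (w%:R <= y)%R%:R)|
  <= coupling_const / Num.sqrt L.
Proof.
move=> L_big.
have m2 : 0 <= m%:R ^+ 2 :> R by exact: sqr_ge0.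
have L0 : 0 < L by lra.
have sL0 : 0 < Num.sqrt L by rewrite sqrtr_gt0.
have nR : 0 < n%:R :> R by rewrite ltr0n.
pose d t : R := if (t.+1 ^ 8 <= n)%N then 1 else 4 / Num.sqrt L.
have dP t s : (t < N)%N ->
    `|pbinom (ps t) (fun w => ((s.+1 + w)%:R <= y)%R%:R) -
      pbinom (ps t) (fun w => ((s + w)%:R <= y)%R%:R)| <= d t.
  move=> tN; have pps := @probs_success_probs R n mm t (ltnW tN).
  apply: (pbinom_jump _ _ pps) => a; rewrite /d; case: ifPn => [_|].
    rewrite -[leRHS](mean1 (pbinom_is_mean pps)); apply: (ler_mean (pbinom_is_mean pps)) => w.
    by case: (_ == _).
  rewrite -ltnNge => tn.
  have t0 : (0 < t)%N by case: (t) tn => //; rewrite exp1n ltnNge n_gt0.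
  have tR : 0 < t%:R :> R by rewrite ltr0n.
  have lnt1 : L <= ln t.+1%:R *+ 8.
    by rewrite -lnXn ?ltr0n // ler_ln ?posrE ?exprn_gt0 ?ltr0n // -natrX ler_nat ltnW.
  have lnt2 : ln t.+1%:R <= 1 + ln t%:R :> R.
    apply: (@le_trans _ _ (ln (1 + 1) + ln t%:R)).
      rewrite -lnM ?posrE // ler_ln ?posrE ?ltr0n ?mulr_gt0 // -natr1.
      by rewrite mulrDl mul1r lerD2l ler1n.
    by rewrite lerD2r le_ln1Dx //; lra.
  have var_ge : L / 16 <= pbinom_var (ps t).
    apply: le_trans (success_probs_var_ge (ltnW tN)).
    by move: lnt1; rewrite -[ln _ *+ 8]mulr_natr; lra.
  have sv : Num.sqrt L / 4 <= Num.sqrt (pbinom_var (ps t)).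
    rewrite -[leLHS]ger0_norm ?divr_ge0 // -[leLHS]sqrtr_sqr ler_wsqrtr //.
    by rewrite expr_div_n sqr_sqrtr ?(ltW L0) // -natrX.
  rewrite ler_pdivlMr //.
  have := pbinom_point_le a pps.
  have : 0 <= pbinom (ps t) (fun w => (w == a)%:R) by apply: (mean_ge0 (pbinom_is_mean pps)) => w.
  nra.
apply: (le_trans (hits_vs_pbinom g_greedy (H := fun w => (w%:R <= y)%R%:R) dP)).
pose b : R := m%:R * Num.sqrt K.
have b0 : 0 <= b by rewrite mulr_ge0.
apply: (@le_trans _ _ (\sum_(t < N) (2 * b / Num.sqrt L * (t.+1%:R ^+ 2)^-1 +
    4 / Num.sqrt L * @spread R n mm t.+1))).
  apply: ler_sum => t _; have sp0 := @spread_ge0 R n mm t.+1.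
  rewrite /d; case: ifPn => [tn|_]; last first.
    rewrite mulrC ler_wpDl // mulr_ge0 ?invr_ge0 ?sqr_ge0 //.
    by rewrite divr_ge0 ?mulr_ge0.
  rewrite mulr1 ler_wpDr ?(mulr_ge0 _ sp0) ?divr_ge0 //.
  have spread_t : (0 < t.+1 <= N)%N by rewrite /= ltn_ord.
  apply: (le_trans (spread_le_sqrt n_gt0 eps_gt0 mm_gt0 max_le frac_ge spread_t)).
  rewrite -/b.
  set c : R := t.+1%:R ^+ 2.
  have c0 : 0 < c by rewrite exprn_gt0.
  (* n^(1/4) dominates both (t + 1)^2 and sqrt (ln n) / 2 *)
  pose r : R := Num.sqrt (Num.sqrt n%:R).
  have rr : r ^+ 2 = Num.sqrt n%:R by rewrite sqr_sqrtr.
  have r0 : 0 < r by rewrite !sqrtr_gt0.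
  have r1 : t.+1%:R ^+ 2 <= r.
    rewrite -[leLHS]ger0_norm ?exprn_ge0 // -[leLHS]sqrtr_sqr ler_wsqrtr //.
    rewrite -[leLHS]ger0_norm ?exprn_ge0 // -[leLHS]sqrtr_sqr ler_wsqrtr //.
    by rewrite -!exprM -natrX ler_nat.
  have r2 : Num.sqrt L <= 2 * r.
    rewrite -[leRHS]ger0_norm ?mulr_ge0 ?(ltW r0) // -[leRHS]sqrtr_sqr ler_wsqrtr //.
    by rewrite exprMn rr; have := ln_le_sqrt nR; have := sqrtr_ge0 (n%:R : R); lra.
  have cr : c * Num.sqrt L <= 2 * r ^+ 2.
    rewrite expr2 mulrCA; apply: (ler_pM (ltW c0) (ltW sL0) r1 r2).
  rewrite (_ : 2 * b / Num.sqrt L * c^-1 = b * (2 / (c * Num.sqrt L))); last first.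
    by field; rewrite !gt_eqF.
  rewrite ler_wpM2l // -rr ler_pdivlMr ?mulr_gt0 // mulrC ler_pdivrMr ?exprn_gt0 //.
rewrite big_split /= -!mulr_sumr.
have s1 := @sum_inv_sqr_le R N; have s2 := sum_spread_le n_gt0 eps_gt0 mm_gt0 max_le frac_ge.
have iL : 0 <= (Num.sqrt L)^-1 by rewrite invr_ge0.
rewrite /coupling_const.
apply: (@le_trans _ _ (2 * b / Num.sqrt L * 2 + 4 / Num.sqrt L * (4 * m%:R * Num.sqrt K))).
  by rewrite lerD // ler_wpM2l // ?mulr_ge0.
by rewrite /b le_eqVlt; apply/orP; left; apply/eqP; ring.
Qed.

Local Notation mu := (score_mean R mm g).
Local Notation v := (score_var R mm g).
Local Notation v' := (pbinom_var (ps N)).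

Definition spread_const : R := 4 * m%:R * Num.sqrt K.
Definition mean_const : R := m%:R * (4 * K + 2 + ln m%:R).

Lemma score_mean_success_probs : mu = pbinom_mean (ps N).
Proof. by rewrite score_meanE -(hits_mean_pbinom g_greedy) /hits_mean subn0. Qed.

Lemma score_mean_log : `|mu - @harmonic_number R M * L| <= mean_const.
Proof.
rewrite score_mean_success_probs success_probs_mean.
exact: mean_top_sum n_gt0 eps_gt0 mm_gt0 max_le frac_ge.
Qed.

Lemma spread_const_ge0 : 0 <= spread_const.
Proof. by rewrite !mulr_ge0. Qed.

Lemma score_var_gap : `|v - v'| <= 2 * spread_const * (Num.sqrt v' + spread_const).
Proof.
have -> : v = @hits_var R n mm g 0.
  by rewrite score_varE /hits_var /hits_mean subn0 score_meanE.
have tot : @total_spread R n mm <= spread_const.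
  exact: sum_spread_le n_gt0 eps_gt0 mm_gt0 max_le frac_ge.
have t0 : 0 <= @total_spread R n mm.
  by apply: sumr_ge0 => t _; exact: spread_ge0.
apply: (le_trans (hits_var_pbinom g_greedy)).
by rewrite ler_pM ?mulr_ge0 ?addr_ge0 ?sqrtr_ge0 // ?lerD2l // ler_wpM2l.
Qed.

Lemma m_ge1 : 1 <= m%:R :> R.
Proof. by rewrite ler1n; exact: m_gt0 n_gt0 mm_gt0 max_le. Qed.

Lemma mean_const_ge0 : 0 <= mean_const.
Proof.
have K1 := @deck_const_ge1 R m eps eps_gt0; have m1 := m_ge1.
by have := ln_ge0 m1; rewrite /mean_const; move=> h; rewrite mulr_ge0 //; lra.
Qed.

Lemma harmonic_bounds : 1 <= @harmonic_number R M <= m%:R.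
Proof.
apply/andP; split; rewrite /harmonic_number.
  rewrite big_ltn ?ltnS ?(max_gt0 n_gt0 mm_gt0) // invr1 lerDl.
  by apply: sumr_ge0 => k _; rewrite invr_ge0.
apply: (@le_trans _ _ (\sum_(1 <= k < M.+1) 1)).
  by apply: ler_sum_nat => k /andP[k0 _]; rewrite invf_le1 ?ltr0n // ler1n.
by rewrite sumr_const_nat subSS subn0 ler_nat.
Qed.

Lemma score_mean_var_bounds :
  [/\ L - 2 - 2 * m%:R ^+ 2 <= v', v' <= mu & mu <= v' + 2 * m%:R ^+ 2].
Proof.
have /andP[h1 h2] := pbinom_mean_var_gap (leqnn N).
have h3 := success_probs_var_ge (leqnn N).
have lnN : L <= ln N%:R.
  rewrite ler_ln ?posrE ?ltr0n ?(ncards_gt0 n_gt0 mm_gt0) // ler_nat.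
  exact: ncards_ge mm_gt0.
by split; rewrite ?score_mean_success_probs; lra.
Qed.

Definition var_const : R := 2 * spread_const * Num.sqrt (m%:R + mean_const)
  + 2 * spread_const ^+ 2 + 2 * m%:R ^+ 2 + mean_const.

Lemma score_var_log : 1 <= L -> `|v - @harmonic_number R M * L| <= var_const * Num.sqrt L.
Proof.
move=> L1; have L0 : 0 <= L by lra.
have [_ v1 v2] := score_mean_var_bounds; have gap := score_var_gap.
have mean := score_mean_log; have /andP[H1 H2] := harmonic_bounds.
have B0 := spread_const_ge0; have c0 := mean_const_ge0.
have sL : 1 <= Num.sqrt L by rewrite -[leLHS]sqrtr1 ler_wsqrtr.
have m2 : 0 <= m%:R ^+ 2 :> R by exact: sqr_ge0.
have v'le : Num.sqrt v' <= Num.sqrt (m%:R + mean_const) * Num.sqrt L.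
  rewrite -sqrtrM ?addr_ge0 // ler_wsqrtr //; apply: (le_trans v1).
  move: mean; rewrite ler_norml => /andP[_ h].
  have : @harmonic_number R M * L <= m%:R * L by rewrite ler_wpM2r.
  have : mean_const <= mean_const * L by rewrite ler_peMr.
  rewrite mulrDl; lra.
have gap' : `|v - v'| <=
    2 * spread_const * Num.sqrt (m%:R + mean_const) * Num.sqrt L + 2 * spread_const ^+ 2.
  apply: (le_trans gap); rewrite mulrDr lerD //.
    by rewrite -[leRHS]mulrA ler_wpM2l // mulr_ge0.
  by rewrite -mulrA -expr2.
have rest : 2 * spread_const ^+ 2 + 2 * m%:R ^+ 2 + mean_const <=
    (2 * spread_const ^+ 2 + 2 * m%:R ^+ 2 + mean_const) * Num.sqrt L.
  by rewrite ler_peMr // !addr_ge0 // mulr_ge0 // sqr_ge0.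
rewrite /var_const !mulrDl in rest *.
move: gap' mean; rewrite !ler_norml => /andP[? ?] /andP[? ?].
by apply/andP; split; lra.
Qed.

(** Above the first summand the Bernoulli sums to come have variance of order ln n.
    Above the second one the standard deviation of the full Bernoulli sum exceeds
    6 spread_const + 1, so that the standard deviation of the score is at least
    half of it. *)
Definition clt_threshold : R := 16 * (3 + 2 * m%:R ^+ 2) + 2 * (6 * spread_const + 1) ^+ 2.
Definition clt_const : R := coupling_const + 2 * berry_const + 16 * spread_const * normal_peak 1.

(** The score has the same mean as the Bernoulli sum. Replacing it by that sum, the sum
    by a normal variable, and the standard deviation of the sum by that of the
    score costs O(1 / sqrt(ln n)) each time. *)
Lemma score_clt x : clt_threshold <= L ->
  `|deal mm N (fun h => (((hits g h)%:R - mu) / Num.sqrt v <= x)%R%:R) - Phi x|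
  <= clt_const / Num.sqrt L.
Proof.
move=> Lbig.
have B0 := spread_const_ge0.
have m2 : 0 <= m%:R ^+ 2 :> R by exact: sqr_ge0.
have B2 : 0 <= (6 * spread_const + 1) ^+ 2 by exact: sqr_ge0.
have L1 : 16 * (3 + 2 * m%:R ^+ 2) <= L by rewrite /clt_threshold in Lbig; lra.
have L0 : 0 < L by lra.
have sL0 : 0 < Num.sqrt L by rewrite sqrtr_gt0.
have [v1 _ _] := score_mean_var_bounds.
have vL : L / 2 <= v' by lra.
set s' := Num.sqrt v'; set s := Num.sqrt v.
have v'0 : 0 < v' by lra.
have s'0 : 0 < s' by rewrite sqrtr_gt0.
have s's' : s' ^+ 2 = v' by rewrite sqr_sqrtr // ltW.
have s'big : 6 * spread_const + 1 <= s'.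
  rewrite -[leLHS]ger0_norm; last by lra.
  by rewrite -[leLHS]sqrtr_sqr ler_wsqrtr //; rewrite /clt_threshold in Lbig; lra.
have s'L : Num.sqrt L <= 2 * s'.
  rewrite -[leRHS]ger0_norm ?mulr_ge0 ?(ltW s'0) // -[leRHS]sqrtr_sqr ler_wsqrtr //.
  by rewrite exprMn s's' expr2; lra.
have is' : s'^-1 <= 2 / Num.sqrt L.
  by rewrite ler_pdivlMr // mulrC ler_pdivrMr.
have gap : `|v - v'| <= 4 * spread_const * s'.
  apply: (le_trans score_var_gap); rewrite -/s'.
  have : spread_const * spread_const <= spread_const * s' by rewrite ler_wpM2l //; lra.
  by rewrite mulrDr -!mulrA; lra.
have v0 : v' / 4 <= v.
  move: gap; rewrite ler_norml => /andP[gap _].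
  by rewrite -s's' in gap *; nra.
have v_gt0 : 0 < v by lra.
have s0 : 0 < s by rewrite sqrtr_gt0.
have ss : s ^+ 2 = v by rewrite sqr_sqrtr // ltW.
pose r := s / s'.
have r_ge : 2^-1 <= r.
  rewrite ler_pdivlMr // -[leLHS]ger0_norm ?mulr_ge0 ?(ltW s'0) //.
  by rewrite -[leLHS]sqrtr_sqr ler_wsqrtr // exprMn s's' expr2; lra.
have r_near : `|r - 1| <= 4 * spread_const / s'.
  have r0 : 0 < r by lra.
  have e : (r - 1) * (r + 1) = (v - v') / v' by rewrite /r -ss -s's'; field; rewrite gt_eqF.
  apply: (@le_trans _ _ (`|r - 1| * (r + 1))); first by rewrite ler_peMr //; lra.
  rewrite -[X in _ * X]gtr0_norm; last by lra.
  rewrite -normrM e normrM (gtr0_norm (x := v'^-1)) ?invr_gt0 // ler_pdivrMr //.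
  rewrite (_ : _ * v' = 4 * spread_const * s') //.
  by rewrite -s's'; field; rewrite gt_eqF.
pose y := mu + s * x.
have evS w : ((w%:R - mu) / s <= x) = (w%:R <= y).
  by rewrite ler_pdivrMr // lerBlDl mulrC.
have evPB w : ((w%:R - pbinom_mean (ps N)) / s' <= r * x) = (w%:R <= y).
  by rewrite -score_mean_success_probs ler_pdivrMr // lerBlDl /r mulrAC divfK // gt_eqF.
have h1 := score_cdf_vs_pbinom y L1.
have h2 := pbinom_berry_esseen (r * x) (probs_success_probs (leqnn N)).
have v'1 : 1 <= v' by lra.
have {}h2 := h2 v'1; rewrite -/s' in h2.
have e2 : pbinom (ps N) (fun w => ((w%:R - pbinom_mean (ps N)) / s' <= r * x)%R%:R) =
   pbinom (ps N) (fun w => (w%:R <= y)%R%:R).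
  by apply: eq_mean => w; rewrite evPB.
rewrite e2 in h2.
have -> : deal mm N (fun h => (((hits g h)%:R - mu) / s <= x)%R%:R) =
   deal mm N (fun h => ((hits g h)%:R <= y)%R%:R) :> R.
  by apply: eq_mean => h; rewrite evS.
have h3 := Phi_dilation x r_ge.
have np0 := @normal_peak_ge0 R 1.
have K1 : 0 <= berry_const :> R by have := @mills_bound_ge1 R; rewrite /berry_const; lra.
have h2' : berry_const / s' <= 2 * berry_const / Num.sqrt L.
  by rewrite [leRHS](_ : _ = berry_const * (2 / Num.sqrt L)) ?ler_wpM2l //; ring.
have h3' : 2 * normal_peak 1 * `|r - 1| <= 16 * spread_const * normal_peak 1 / Num.sqrt L.
  apply: (@le_trans _ _ (2 * normal_peak 1 * (4 * spread_const * (2 / Num.sqrt L)))).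
    by rewrite ler_wpM2l ?mulr_ge0 // (le_trans r_near) // ler_wpM2l ?mulr_ge0.
  by rewrite le_eqVlt; apply/orP; left; apply/eqP; ring.
rewrite /clt_const !mulrDl.
set P1 := deal mm N _ in h1 *; set P2 := pbinom _ _ in h1 h2.
have := le_trans h3 h3'; have := le_trans h2 h2'; move: h1.
rewrite !ler_norml => /andP[? ?] /andP[? ?] /andP[? ?].
by apply/andP; split; lra.
Qed.

End GameDeck.

(** * The limit theorem *)

Section Asymptotics.
Context {R : realType}.

Lemma ln_eventually_ge (x : R) : exists n0, forall n, (n0 <= n)%N -> x <= ln n%:R.
Proof.
exists (Num.truncn (expR x)).+1 => n n0n.
have h : expR x <= n%:R.
  by apply: (@le_trans _ _ (Num.truncn (expR x)).+1%:R); rewrite ?ler_nat // ltW // truncnS_gt.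
by rewrite -[leLHS]expRK ler_ln ?posrE ?expR_gt0 // (lt_le_trans (expR_gt0 x)).
Qed.

Lemma asymp_equiv_sqrt (a b : R^nat) (c : R) (n0 : nat) :
  (forall n, (n0 <= n)%N -> `|a n - b n| <= c * Num.sqrt (ln n%:R)) ->
  (forall n, (n0 <= n)%N -> ln n%:R <= 2 * b n) ->
  asymp_equiv a b.
Proof.
move=> ab bL; apply/cvgrPdist_le => e e0.
have [n1 n1P] := ln_eventually_ge (Num.max 1 ((2 * c / e) ^+ 2)).
exists (maxn n0 n1) => // n /=; rewrite geq_max => /andP[n0n n1n].
have := n1P n n1n; rewrite ge_max => /andP[L1 Lc].
have {}ab := ab n n0n; have {}bL := bL n n0n.
set L := ln n%:R in L1 Lc ab bL.
have b0 : 0 < b n by lra.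
have L0 : 0 < L by lra.
have sL0 : 0 < Num.sqrt L by rewrite sqrtr_gt0.
have LL : Num.sqrt L * Num.sqrt L = L by rewrite -expr2 sqr_sqrtr // ltW.
have cs : 2 * c / e <= Num.sqrt L.
  by rewrite (le_trans (ler_norm _)) // -sqrtr_sqr ler_wsqrtr.
rewrite distrC (_ : a n / b n - 1 = (a n - b n) / b n); last by field; rewrite gt_eqF.
rewrite normrM (gtr0_norm (x := (b n)^-1)) ?invr_gt0 // ler_pdivrMr //.
apply: (le_trans ab).
rewrite ler_pdivrMr // in cs.
have : e * L <= e * (2 * b n) by rewrite ler_wpM2l // ltW.
have : 2 * c * Num.sqrt L <= Num.sqrt L * e * Num.sqrt L by rewrite ler_wpM2r // ltW.
have -> : Num.sqrt L * e * Num.sqrt L = e * L by rewrite mulrAC LL mulrC.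
lra.
Qed.

(** The bound 5/6 <= exp(-1/6) gives exp(1) <= (6/5)^6 < 3. *)
Lemma ln3_gt1 : 1 < ln 3 :> R.
Proof.
have e6 : expR (6^-1 : R) <= 6 / 5.
  have h : 5 / 6 <= expR (- 6^-1 : R) by apply: le_trans (expR_ge1Dx _); lra.
  have hp := expR_gt0 (6^-1 : R).
  have hm : expR (- 6^-1) * expR (6^-1 : R) = 1 by rewrite expRN mulVf // gt_eqF.
  nra.
have e1 : expR 1 < 3 :> R.
  have -> : expR 1 = expR (6^-1 : R) ^+ 6 by rewrite -expRM_natl; congr expR; field.
  apply: (@le_lt_trans _ _ ((6 / 5) ^+ 6)); last by rewrite !exprS expr0; lra.
  by rewrite lerXn2r ?nnegrE ?expR_ge0 //; lra.
by rewrite -[ltLHS]expRK ltr_ln ?posrE ?expR_gt0.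
Qed.

End Asymptotics.

Theorem theorem1p2 (R : realType) (m : nat) (eps : R) :
  (1 <= m)%N -> 0 < eps ->
  exists C : R,
  forall (mm : forall n, 'I_n -> nat) (g : forall n, strategy n),
    (forall n, (1 <= n)%N ->
       [/\ (forall i, (1 <= mm n i)%N),
           (max_mult (mm n) <= m)%N,
           eps <= max_frac R (mm n)
         & greedy (mm n) (g n)]) ->
    let mu n : R := score_mean R (mm n) (g n) in
    let var n : R := score_var R (mm n) (g n) in
    let sigma n : R := Num.sqrt (var n) in
    [/\ asymp_equiv mu var,
        asymp_equiv var (fun n =>
          (\sum_(1 <= k < (max_mult (mm n)).+1) k%:R^-1) * ln n%:R)
      & forall n, (3 <= n)%N ->
          (ereal_sup
             [set `|shuffle R (mm n)
                      [set w | ((score R (mm n) (g n) w - mu n) / sigma n <= x)%R]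
                    - std_normal_cdf x| | x in [set: R]]
           <= (C * (ln (ln n%:R) / Num.sqrt (ln n%:R)))%:E)%E].
Proof.
move=> _ eps0.
pose L1 := @clt_threshold R m eps.
(* If ln n < L1, then the trivial bound 1 is at most sqrt L1 / sqrt (ln n). *)
pose D := @clt_const R m eps + Num.sqrt L1.
exists (D / ln (ln 3)) => mm g hyp mu var sigma.
have Lpos n : (3 <= n)%N -> 1 < ln n%:R :> R.
  move=> n3; apply: lt_le_trans ln3_gt1 _.
  by rewrite ler_ln ?posrE ?ltr0n ?(leq_trans _ n3) // ler_nat.
have facts n : (3 <= n)%N ->
    [/\ `|mu n - @harmonic_number R (max_mult (mm n)) * ln n%:R| <=
           @mean_const R m eps * Num.sqrt (ln n%:R),
        `|var n - @harmonic_number R (max_mult (mm n)) * ln n%:R| <=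
           @var_const R m eps * Num.sqrt (ln n%:R)
      & ln n%:R <= @harmonic_number R (max_mult (mm n)) * ln n%:R].
  move=> n3; have n0 : (0 < n)%N by rewrite (leq_trans _ n3).
  have [h1 h2 h3 h4] := hyp n n0; have L_gt1 := Lpos n n3.
  have sL : 1 <= Num.sqrt (ln n%:R) :> R by rewrite -[leLHS]sqrtr1 ler_wsqrtr // ltW.
  split.
  - apply: (le_trans (score_mean_log n0 eps0 h1 h2 h3 h4)).
    by rewrite ler_peMr // (mean_const_ge0 n0 eps0 h1 h2).
  - by apply: (score_var_log n0 eps0 h1 h2 h3 h4); exact: ltW.
  - have /andP[H1 _] := @harmonic_bounds R n (mm n) m n0 h1 h2.
    by rewrite ler_peMl //; lra.
split.
- have [n1 n1P] := ln_eventually_ge ((2 * @var_const R m eps) ^+ 2).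
  apply: (@asymp_equiv_sqrt R mu var (@mean_const R m eps + @var_const R m eps) (maxn 3 n1)) => n;
    rewrite geq_max => /andP[n3 n1n]; have [f1 f2 f3] := facts n n3.
    rewrite mulrDl; move: f1 f2; rewrite !ler_norml => /andP[? ?] /andP[? ?].
    by apply/andP; split; lra.
  have L_gt1 := Lpos n n3.
  have sL : 2 * @var_const R m eps <= Num.sqrt (ln n%:R).
    by rewrite (le_trans (ler_norm _)) // -sqrtr_sqr ler_wsqrtr // n1P.
  have : 2 * @var_const R m eps * Num.sqrt (ln n%:R) <= ln n%:R.
    have LL : Num.sqrt (ln n%:R) * Num.sqrt (ln n%:R) = ln n%:R :> R.
      by rewrite -expr2 sqr_sqrtr //; lra.
    by rewrite -[leRHS]LL ler_wpM2r.
  by move: f2; rewrite ler_norml => /andP[? ?]; lra.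
- apply: (@asymp_equiv_sqrt R var _ (@var_const R m eps) 3) => n n3;
    have [f1 f2 f3] := facts n n3 => //.
  by rewrite -/(harmonic_number _); have := Lpos n n3; lra.
move=> n n3; have n0 : (0 < n)%N by rewrite (leq_trans _ n3).
have [h1 h2 h3 h4] := hyp n n0; have L_gt1 := Lpos n n3.
have sL0 : 0 < Num.sqrt (ln n%:R) :> R by rewrite sqrtr_gt0; lra.
apply: ub_ereal_sup => _ [x _ <-].
have -> : [set w | ((score R (mm n) (g n) w - mu n) / sigma n <= x)%R] =
    [set w | ((hits (g n) (cards w))%:R - mu n) / sigma n <= x].
  by apply/seteqP; split => w /=; rewrite scoreE.
rewrite (@shuffle_deal R n (mm n) (fun h => ((hits (g n) h)%:R - mu n) / sigma n <= x)).
rewrite std_normal_cdfE -EFinB lee_fin.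
set P := deal _ _ _.
have D0 : 0 <= @clt_const R m eps.
  rewrite /clt_const /coupling_const /spread_const /berry_const.
  have K1 := @mills_bound_ge1 R; have np := @normal_peak_ge0 R 1.
  by rewrite !addr_ge0 ?mulr_ge0 //; lra.
have base : `|P - Phi x| <= D / Num.sqrt (ln n%:R).
  have [Lbig|Lsmall] := leP L1 (ln n%:R).
    apply: (le_trans (score_clt n0 eps0 h1 h2 h3 h4 x Lbig)).
    by rewrite ler_pM2r ?invr_gt0 // lerDl.
  have P0 : 0 <= P <= 1.
    have mE := @deal_is_mean R n (mm n) _ (leqnn (ncards (mm n))).
    apply/andP; split; first by apply: (mean_ge0 mE) => h.
    by rewrite -[leRHS](mean1 mE); apply: (ler_mean mE) => h; case: (_ <= x).
  have /andP[P1 P2] := P0; have F1 := Phi_ge0 x; have F2 := Phi_le1 x.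
  apply: (@le_trans _ _ 1); first by rewrite ler_norml; lra.
  rewrite ler_pdivlMr // mul1r (le_trans (ler_wsqrtr (ltW Lsmall))) // lerDr //.
apply: (le_trans base).
have lnln : ln (ln 3) <= ln (ln n%:R) :> R.
  rewrite ler_ln ?posrE ?(lt_trans _ ln3_gt1) ?(lt_trans _ L_gt1) //.
  by rewrite ler_ln ?posrE ?ltr0n // ler_nat.
have ln3 : 0 < ln (ln 3) :> R by rewrite ln_gt0 // ln3_gt1.
have D0' : 0 <= D by rewrite addr_ge0.
rewrite mulrA ler_pM2r ?invr_gt0 // -mulrA ler_peMr //.
by rewrite mulrC ler_pdivlMr // mul1r.
Qed.
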